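(* Let $i:\mathbf{A}\to\mathbf{B}$ be either of the following full inclusions of categories: $c\,\mathrm{Sd}^2\Lambda^k[m]\to c\,\mathrm{Sd}^2\Delta[m]$, or $\{1\}\to\mathbf{I}$. Let $\mathbf{C}$ be a category, $\mathbb{D}$ a double category, $F:\mathbf{A}\boxtimes\mathbf{C}\to\mathbb{D}$ a double functor, and let $\mathbb{P}$ be the pushout in $\mathbf{DblCat}$ of $F$ along $i\boxtimes 1_{\mathbf{C}}:\mathbf{A}\boxtimes\mathbf{C}\to\mathbf{B}\boxtimes\mathbf{C}$. Then $\mathbb{P}$ has the following explicit description. Objects: $\mathrm{Obj}\,\mathbb{P}=\mathrm{Obj}\,\mathbb{D}\coprod\big((\mathrm{Obj}\,\mathbf{B}\setminus\mathrm{Obj}\,\mathbf{A})\times\mathrm{Obj}\,\mathbf{C}\big)$. Horizontal 1-category: $(\mathbf{H}\mathbb{P})_0=(\mathbf{H}\mathbb{D})_0\coprod\big((\mathrm{Obj}\,\mathbf{B}\setminus\mathrm{Obj}\,\mathbf{A})_{\mathrm{disc}}\times\mathbf{C}\big)$. Vertical morphisms: the vertical morphisms of $\mathbb{P}$ are those of the following two forms: (a) a morphism $(f',c):(B_0,c)\to(B_1,c)$ with $c\in\mathrm{Obj}\,\mathbf{C}$ and $f'\in\mathrm{Mor}\,\mathbf{B}\setminus\mathrm{Mor}\,\mathbf{A}$; (b) a composite path $X_1\xrightarrow{f_1}D_1\xrightarrow{d}D_2\xrightarrow{f_2}X_2$ where $d$ is a vertical morphism of $\mathbb{D}$ and each of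 $f_1,f_2$ is either an identity or in $(\mathrm{Mor}\,\mathbf{B}\setminus\mathrm{Mor}\,\mathbf{A})\times\mathrm{Obj}\,\mathbf{C}$; moreover if $f_1$ is not an identity it has the form $(f_1',c_1):(B_1,c_1)\to(A_1,c_1)$, and if $f_2$ is not an identity it has the form $(f_2',c_2):(A_2,c_2)\to(B_2,c_2)$, with $c_1,c_2\in\mathrm{Obj}\,\mathbf{C}$, $B_1,B_2\in\mathrm{Obj}\,\mathbf{B}\setminus\mathrm{Obj}\,\mathbf{A}$, $A_1,A_2\in\mathrm{Obj}\,\mathbf{A}$, $f_1',f_2'\in\mathrm{Mor}\,\mathbf{B}\setminus\mathrm{Mor}\,\mathbf{A}$ (objects $(A_j,c_j)$ of $\mathbf{A}\boxtimes\mathbf{C}$ being identified with their images in $\mathbb{D}$). Squares: the squares of $\mathbb{P}$ have two forms: (i) a square $\beta$ in $\mathrm{Sq}(\mathbf{B}\boxtimes\mathbf{C})\setminus\mathrm{Sq}(\mathbf{A}\boxtimes\mathbf{C})$; (ii) a vertical composite, from top to bottom, of $\beta_1$, $\delta$, $\beta_2$, where $\delta$ is a square in $\mathbb{D}$ and each of $\beta_1$ and $\beta_2$ is either a vertical identity square (on a horizontal morphism) in $\mathbb{P}$ or is in $\mathrm{Sq}(\mathbf{B}\boxtimes\mathbf{C})\setminus\mathrm{Sq}(\mathbf{A}\boxtimes\mathbf{C})$. Moreover, in the case of $c\,\mathrm{Sd}^2\Lambda^k[m]\to c\,\mathrm{Sd}^2\Delta[m]$, the square $\beta_1$ is always a vertical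 identity square.
   Context: A small double category is an internal category in $\mathbf{Cat}$; it has objects, horizontal morphisms, vertical morphisms and squares ($\mathrm{Sq}$). $\mathbf{DblCat}$ is the category of small double categories and double functors. $(\mathbf{H}\mathbb{D})_0$ denotes the category of objects and horizontal morphisms of $\mathbb{D}$. For a set $S$, $S_{\mathrm{disc}}$ is the discrete category on $S$. The external product $\mathbf{B}\boxtimes\mathbf{C}$ of categories is the double category with objects $\mathrm{Obj}\,\mathbf{B}\times\mathrm{Obj}\,\mathbf{C}$, vertical morphisms $(f,C):(B,C)\to(B',C)$ for $f:B\to B'$ in $\mathbf{B}$, horizontal morphisms $(B,g):(B,C)\to(B,C')$ for $g:C\to C'$ in $\mathbf{C}$, and exactly one square for each pair $(f,g)$ (with left side $(f,C)$, right side $(f,C')$, top $(B,g)$, bottom $(B',g)$). Thus $\mathrm{Sq}(\mathbf{B}\boxtimes\mathbf{C})\setminus\mathrm{Sq}(\mathbf{A}\boxtimes\mathbf{C})$ is the set of squares given by pairs $(f,g)$ with $g\in\mathrm{Mor}\,\mathbf{C}$ and $f\in\mathrm{Mor}\,\mathbf{B}\setminus\mathrm{Mor}\,\mathbf{A}$. Elements of $\mathbb{D}$ and of $\mathbf{B}\boxtimes\mathbf{C}$ are regarded in $\mathbb{P}$ via the canonical double functors. $\mathrm{Sd}$ is barycentric subdivision of simplicial sets and $c:\mathbf{SSet}\to\mathbf{Cat}$ is the left adjoint to the nerve. Explicitly, $\mathrm{Sd}\Delta[m]$ and $\mathrm{Sd}\Lambda^k[m]$ are the nerves of the posets (under the face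 relation) of nondegenerate simplices of $\Delta[m]$ and of the horn $\Lambda^k[m]$, and $c\,\mathrm{Sd}^2\Delta[m]$ and $c\,\mathrm{Sd}^2\Lambda^k[m]$ are the posets of nondegenerate simplices of $\mathrm{Sd}\Delta[m]$ and $\mathrm{Sd}\Lambda^k[m]$; i.e. elements are nonempty chains $v_0<\dots<v_q$ of faces of $\Delta[m]$ (respectively of $\Lambda^k[m]$), ordered by inclusion of the sets $\{v_0,\dots,v_q\}$. $\mathbf{I}$ is the category with two objects $0,1$ and a unique isomorphism between them (four morphisms in all); $\{1\}$ is its full subcategory on $1$. *)

(* Defs.v *)
From mathcomp Require Import all_boot boolp.

Set Implicit Arguments.
Unset Strict Implicit.
Unset Printing Implicit Defensive.

(* A category is an internal category in sets: a type of objects, a type of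
   arrows, and a composition defined on composable pairs.  Composition is in
   diagrammatic order: [ccomp X e] is "f, then g" for [e : tgt f = src g].
   The laws quantify over all proofs of composability. *)
Record cat_on (O M : Type) : Type := CatOn {
  csrc : M -> O;
  ctgt : M -> O;
  cid : O -> M;
  ccomp : forall f g : M, ctgt f = csrc g -> M;
  csrc_id : forall x, csrc (cid x) = x;
  ctgt_id : forall x, ctgt (cid x) = x;
  csrc_comp : forall f g (e : ctgt f = csrc g), csrc (ccomp e) = csrc f;
  ctgt_comp : forall f g (e : ctgt f = csrc g), ctgt (ccomp e) = ctgt g;
  ccomp_idl : forall f (e : ctgt (cid (csrc f)) = csrc f), ccomp e = f;
  ccomp_idr : forall f (e : ctgt f = csrc (cid (ctgt f))), ccomp e = f;
  ccompA : forall f g h (efg : ctgt f = csrc g) (egh : ctgt g = csrc h)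
    (e1 : ctgt (ccomp efg) = csrc h) (e2 : ctgt f = csrc (ccomp egh)),
    ccomp e1 = ccomp e2
}.
Arguments ccomp {O M} c {f g} _.

Record category : Type := Category {
  Ob : Type;
  Mor : Type;
  cat_str :> cat_on Ob Mor
}.

Record is_functor (O M O' M' : Type) (X : cat_on O M) (Y : cat_on O' M')
    (fo : O -> O') (fm : M -> M') : Prop := IsFunctor {
  fun_src : forall f, csrc Y (fm f) = fo (csrc X f);
  fun_tgt : forall f, ctgt Y (fm f) = fo (ctgt X f);
  fun_id : forall x, fm (cid X x) = cid Y (fo x);
  fun_comp : forall f g (e : ctgt X f = csrc X g)
    (e' : ctgt Y (fm f) = csrc Y (fm g)), fm (ccomp X e) = ccomp Y e'
}.

Record functor (A B : category) : Type := Functor {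
  fob : Ob A -> Ob B;
  fmor : Mor A -> Mor B;
  functorP : is_functor A B fob fmor
}.

Lemma is_functor_comp (O1 M1 O2 M2 O3 M3 : Type) (X1 : cat_on O1 M1)
    (X2 : cat_on O2 M2) (X3 : cat_on O3 M3) fo fm go gm :
  is_functor X1 X2 fo fm -> is_functor X2 X3 go gm ->
  is_functor X1 X3 (go \o fo) (gm \o fm).
Proof.
move=> [fs ft fi fc] [gs gt gi gc]; split=> /=.
- by move=> f; rewrite gs fs.
- by move=> f; rewrite gt ft.
- by move=> x; rewrite fi gi.
- move=> f g e e'; have e2 : ctgt X2 (fm f) = csrc X2 (fm g) by rewrite ft fs e.
  by rewrite (fc _ _ e e2) (gc _ _ e2 e').
Qed.

Lemma is_functor_id (O M : Type) (X : cat_on O M) : is_functor X X id id.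
Proof. by split=> // f g e e'; congr ccomp; apply: Prop_irrelevance. Qed.

Definition functor_comp (A B C : category) (F : functor A B) (G : functor B C) :
  functor A C := Functor (is_functor_comp (functorP F) (functorP G)).

Definition functor_id (A : category) : functor A A :=
  Functor (is_functor_id A).

Definition functor_eq (A B : category) (F G : functor A B) : Prop :=
  fob F =1 fob G /\ fmor F =1 fmor G.

Definition is_iso_functor (A B : category) (F : functor A B) : Prop :=
  exists G : functor B A,
    functor_eq (functor_comp F G) (functor_id A) /\
    functor_eq (functor_comp G F) (functor_id B).

Definition disc_on (S : Type) : cat_on S S.
Proof. by refine (@CatOn S S id id id (fun f g _ => f) _ _ _ _ _ _ _). Defined.

Definition disc (S : Type) : category := Category (disc_on S).

Lemma is_functor_disc (S T : Type) (f : S -> T) :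
  is_functor (disc_on S) (disc_on T) f f.
Proof. by []. Qed.

Section Product.
Variables (O M O' M' : Type) (X : cat_on O M) (Y : cat_on O' M').

Definition pair_src (p : M * M') := (csrc X p.1, csrc Y p.2).
Definition pair_tgt (p : M * M') := (ctgt X p.1, ctgt Y p.2).
Definition pair_comp (p q : M * M') (e : pair_tgt p = pair_src q) : M * M' :=
  (ccomp X (congr1 fst e), ccomp Y (congr1 snd e)).

Definition prod_on : cat_on (O * O') (M * M').
Proof.
refine (@CatOn _ _ pair_src pair_tgt (fun x => (cid X x.1, cid Y x.2))
  pair_comp _ _ _ _ _ _ _).
- by case=> x y; rewrite /pair_src /= !csrc_id.
- by case=> x y; rewrite /pair_tgt /= !ctgt_id.
- by move=> f g e; rewrite /pair_src /= !csrc_comp.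
- by move=> f g e; rewrite /pair_tgt /= !ctgt_comp.
- by case=> f g e; rewrite /pair_comp /= !ccomp_idl.
- by case=> f g e; rewrite /pair_comp /= !ccomp_idr.
- by move=> f g h e1 e2 e3 e4; congr pair; apply: ccompA.
Defined.
End Product.

Definition prod_cat (A B : category) : category := Category (prod_on A B).

Lemma is_functor_prod (O1 M1 O2 M2 O3 M3 O4 M4 : Type) (X1 : cat_on O1 M1)
    (X2 : cat_on O2 M2) (Y1 : cat_on O3 M3) (Y2 : cat_on O4 M4) fo fm go gm :
  is_functor X1 Y1 fo fm -> is_functor X2 Y2 go gm ->
  is_functor (prod_on X1 X2) (prod_on Y1 Y2)
    (fun x => (fo x.1, go x.2)) (fun f => (fm f.1, gm f.2)).
Proof.
move=> [fs ft fi fc] [gs gt gi gc]; split=> /=.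
- by move=> f; rewrite /pair_src /= fs gs.
- by move=> f; rewrite /pair_tgt /= ft gt.
- by move=> x; rewrite fi gi.
- by move=> f g e e'; congr pair; [apply: fc|apply: gc].
Qed.

Section Coproduct.
Variables (O M O' M' : Type) (X : cat_on O M) (Y : cat_on O' M').

Definition sum_src (f : M + M') : O + O' :=
  match f with inl a => inl (csrc X a) | inr b => inr (csrc Y b) end.
Definition sum_tgt (f : M + M') : O + O' :=
  match f with inl a => inl (ctgt X a) | inr b => inr (ctgt Y b) end.
Definition sum_id (x : O + O') : M + M' :=
  match x with inl a => inl (cid X a) | inr b => inr (cid Y b) end.

Lemma inl_injective (a b : O) : inl O' a = inl b -> a = b.
Proof. by case. Qed.
Lemma inr_injective (a b : O') : inr O a = inr b -> a = b.
Proof. by case. Qed.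
Lemma inl_neq_inr (a : O) (b : O') : inl a = inr b -> False.
Proof. by []. Qed.
Lemma inr_neq_inl (a : O) (b : O') : inr b = inl a -> False.
Proof. by []. Qed.

Definition sum_comp (f g : M + M') : sum_tgt f = sum_src g -> M + M' :=
  match f, g return sum_tgt f = sum_src g -> M + M' with
  | inl a, inl b => fun e => inl (ccomp X (inl_injective e))
  | inr a, inr b => fun e => inr (ccomp Y (inr_injective e))
  | inl _, inr _ => fun e => False_rect _ (inl_neq_inr e)
  | inr _, inl _ => fun e => False_rect _ (inr_neq_inl e)
  end.

Definition sum_on : cat_on (O + O') (M + M').
Proof.
refine (@CatOn _ _ sum_src sum_tgt sum_id sum_comp _ _ _ _ _ _ _).
- by case=> x /=; rewrite csrc_id.
- by case=> x /=; rewrite ctgt_id.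
- by case=> f [] g e //=; rewrite csrc_comp.
- by case=> f [] g e //=; rewrite ctgt_comp.
- by case=> f e /=; rewrite ccomp_idl.
- by case=> f e /=; rewrite ccomp_idr.
- case=> f [] g [] h //= e1 e2 e3 e4; congr (_ _); exact: ccompA.
Defined.
End Coproduct.

Definition coprod_cat (A B : category) : category := Category (sum_on A B).

Definition sum_map (S S' T : Type) (f : S -> T) (g : S' -> T) (x : S + S') : T :=
  match x with inl a => f a | inr b => g b end.

Lemma is_functor_copair (A B C : category) (F : functor A C) (G : functor B C) :
  is_functor (coprod_cat A B) C
    (sum_map (fob F) (fob G)) (sum_map (fmor F) (fmor G)).
Proof.
case: F G => [fo fm [fs ft fi fc]] [go gm [gs gt gi gc]]; split=> /=.
- by case=> f /=; rewrite (fs, gs).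
- by case=> f /=; rewrite (ft, gt).
- by case=> x /=; rewrite (fi, gi).
- by case=> f [] g //= e e'; rewrite (fc, gc).
Qed.

Definition copair (A B C : category) (F : functor A C) (G : functor B C) :
  functor (coprod_cat A B) C := Functor (is_functor_copair F G).

Section FullSubcategory.
Variables (B : category) (P : pred (Ob B)).

Definition sub_mor : pred (Mor B) := fun f => P (csrc B f) && P (ctgt B f).

Definition sub_src (f : {f | sub_mor f}) : {x | P x} :=
  exist _ (csrc B (sval f)) (proj1 (andP (svalP f))).
Definition sub_tgt (f : {f | sub_mor f}) : {x | P x} :=
  exist _ (ctgt B (sval f)) (proj2 (andP (svalP f))).

Lemma sub_id_subproof (x : {x | P x}) : sub_mor (cid B (sval x)).
Proof. by rewrite /sub_mor csrc_id ctgt_id (svalP x). Qed.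
Definition sub_id (x : {x | P x}) : {f | sub_mor f} :=
  exist _ (cid B (sval x)) (sub_id_subproof x).

Lemma sub_comp_subproof (f g : {f | sub_mor f})
  (e : ctgt B (sval f) = csrc B (sval g)) : sub_mor (ccomp B e).
Proof.
rewrite /sub_mor csrc_comp ctgt_comp.
by case/andP: (svalP f) => -> _; case/andP: (svalP g).
Qed.
Definition sub_comp (f g : {f | sub_mor f}) (e : sub_tgt f = sub_src g) :
  {f | sub_mor f} :=
  exist _ (ccomp B (congr1 sval e)) (sub_comp_subproof (congr1 sval e)).

Definition full_sub_on : cat_on {x | P x} {f | sub_mor f}.
Proof.
refine (@CatOn _ _ sub_src sub_tgt sub_id sub_comp _ _ _ _ _ _ _).
- by move=> x; apply: val_inj; rewrite /= csrc_id.
- by move=> x; apply: val_inj; rewrite /= ctgt_id.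
- by move=> f g e; apply: val_inj; rewrite /= csrc_comp.
- by move=> f g e; apply: val_inj; rewrite /= ctgt_comp.
- by move=> f e; apply: val_inj; rewrite /= ccomp_idl.
- by move=> f e; apply: val_inj; rewrite /= ccomp_idr.
- by move=> f g h e1 e2 e3 e4; apply: val_inj; apply: ccompA.
Defined.

Definition full_sub : category := Category full_sub_on.

Lemma is_functor_full_incl : is_functor full_sub B sval sval.
Proof. by split=> // f g e e'; congr ccomp; apply: Prop_irrelevance. Qed.

Definition full_incl : functor full_sub B := Functor is_functor_full_incl.
End FullSubcategory.

Section Preorder.
Variables (T : Type) (r : rel T) (rr : reflexive r) (rt : transitive r).

Definition pre_mor : Type := {p : T * T | r p.1 p.2}.
Definition pre_src (f : pre_mor) : T := (sval f).1.
Definition pre_tgt (f : pre_mor) : T := (sval f).2.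
Definition pre_id (x : T) : pre_mor := exist _ (x, x) (rr x).

Lemma pre_comp_subproof (f g : pre_mor) :
  pre_tgt f = pre_src g -> r (pre_src f) (pre_tgt g).
Proof.
move=> e; apply: (rt (svalP f)); rewrite -/(pre_tgt f) e; exact: svalP g.
Qed.
Definition pre_comp (f g : pre_mor) (e : pre_tgt f = pre_src g) : pre_mor :=
  exist _ (pre_src f, pre_tgt g) (pre_comp_subproof e).

Definition preorder_on : cat_on T pre_mor.
Proof.
refine (@CatOn _ _ pre_src pre_tgt pre_id pre_comp _ _ _ _ _ _ _) => //.
- by case=> [[x y] ?] e; apply: val_inj.
- by case=> [[x y] ?] e; apply: val_inj.
- by move=> f g h e1 e2 e3 e4; apply: val_inj.
Defined.

Definition preorder_cat : category := Category preorder_on.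
End Preorder.

(* An internal category in Cat.  The category of objects is [vcat] (objects
   and vertical morphisms), the category of arrows is [vsq] (horizontal
   morphisms and squares, composed vertically).  In [hsq] (squares, composed
   horizontally) the source and target of a square are its left and right
   sides; in [vsq] they are its top and bottom.  The last seven fields say
   that source, target, identity and composition are functors for the vertical
   structure, the last four of them dealing with composition. *)
Record dblcat : Type := DblCat {
  dob : Type;
  hmor : Type;
  vmor : Type;
  sq : Type;
  hcat : cat_on dob hmor;
  vcat : cat_on dob vmor;
  hsq : cat_on vmor sq;
  vsq : cat_on hmor sq;
  left_functor : is_functor vsq vcat (csrc hcat) (csrc hsq);
  right_functor : is_functor vsq vcat (ctgt hcat) (ctgt hsq);
  hid_functor : is_functor vcat vsq (cid hcat) (cid hsq);
  top_hcomp : forall a b (e : ctgt hsq a = csrc hsq b)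
    (e' : ctgt hcat (csrc vsq a) = csrc hcat (csrc vsq b)),
    csrc vsq (ccomp hsq e) = ccomp hcat e';
  bot_hcomp : forall a b (e : ctgt hsq a = csrc hsq b)
    (e' : ctgt hcat (ctgt vsq a) = csrc hcat (ctgt vsq b)),
    ctgt vsq (ccomp hsq e) = ccomp hcat e';
  vid_hcomp : forall h k (e : ctgt hcat h = csrc hcat k)
    (e' : ctgt hsq (cid vsq h) = csrc hsq (cid vsq k)),
    cid vsq (ccomp hcat e) = ccomp hsq e';
  interchange : forall a b c d
    (eab : ctgt hsq a = csrc hsq b) (ecd : ctgt hsq c = csrc hsq d)
    (eac : ctgt vsq a = csrc vsq c) (ebd : ctgt vsq b = csrc vsq d)
    (e1 : ctgt vsq (ccomp hsq eab) = csrc vsq (ccomp hsq ecd))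
    (e2 : ctgt hsq (ccomp vsq eac) = csrc hsq (ccomp vsq ebd)),
    ccomp vsq e1 = ccomp hsq e2
}.

Record dblfunctor (D E : dblcat) : Type := DblFunctor {
  dfob : dob D -> dob E;
  dfh : hmor D -> hmor E;
  dfv : vmor D -> vmor E;
  dfsq : sq D -> sq E;
  df_hcat : is_functor (hcat D) (hcat E) dfob dfh;
  df_vcat : is_functor (vcat D) (vcat E) dfob dfv;
  df_hsq : is_functor (hsq D) (hsq E) dfv dfsq;
  df_vsq : is_functor (vsq D) (vsq E) dfh dfsq
}.

Definition dblfunctor_comp (D E G : dblcat) (F : dblfunctor D E)
    (F' : dblfunctor E G) : dblfunctor D G :=
  DblFunctor (is_functor_comp (df_hcat F) (df_hcat F'))
             (is_functor_comp (df_vcat F) (df_vcat F'))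
             (is_functor_comp (df_hsq F) (df_hsq F'))
             (is_functor_comp (df_vsq F) (df_vsq F')).

Definition dblfunctor_eq (D E : dblcat) (F G : dblfunctor D E) : Prop :=
  [/\ dfob F =1 dfob G, dfh F =1 dfh G, dfv F =1 dfv G & dfsq F =1 dfsq G].

Definition is_pushout (S D E P : dblcat) (F : dblfunctor S D)
    (G : dblfunctor S E) (u : dblfunctor D P) (v : dblfunctor E P) : Prop :=
  dblfunctor_eq (dblfunctor_comp F u) (dblfunctor_comp G v) /\
  forall (X : dblcat) (s : dblfunctor D X) (t : dblfunctor E X),
    dblfunctor_eq (dblfunctor_comp F s) (dblfunctor_comp G t) ->
    exists w : dblfunctor P X,
      (dblfunctor_eq (dblfunctor_comp u w) s /\
       dblfunctor_eq (dblfunctor_comp v w) t) /\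
      forall w' : dblfunctor P X,
        dblfunctor_eq (dblfunctor_comp u w') s ->
        dblfunctor_eq (dblfunctor_comp v w') t ->
        dblfunctor_eq w' w.

Definition hcategory (D : dblcat) : category := Category (hcat D).

Definition hfunctor (D E : dblcat) (F : dblfunctor D E) :
  functor (hcategory D) (hcategory E) :=
  @Functor (hcategory D) (hcategory E) _ _ (df_hcat F).

(* The square given by (f, g) has top (src f, g), bottom (tgt f, g),
   left side (f, src g) and right side (f, tgt g). *)
Definition extprod (B C : category) : dblcat.
Proof.
refine (@DblCat (Ob B * Ob C) (Ob B * Mor C) (Mor B * Ob C) (Mor B * Mor C)
  (prod_on (disc_on (Ob B)) C) (prod_on B (disc_on (Ob C)))
  (prod_on (disc_on (Mor B)) C) (prod_on B (disc_on (Mor C)))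
  _ _ _ _ _ _ _).
- split=> //= f g e e'; rewrite /pair_comp /=.
  by congr (ccomp _ _, _); apply: Prop_irrelevance.
- split=> //= f g e e'; rewrite /pair_comp /=.
  by congr (ccomp _ _, _); apply: Prop_irrelevance.
- split=> //= f g e e'; rewrite /pair_comp /=.
  by congr (ccomp _ _, _); apply: Prop_irrelevance.
- move=> a b e e'; rewrite /= /pair_src /pair_comp /=.
  by congr (_, ccomp _ _); apply: Prop_irrelevance.
- move=> a b e e'; rewrite /= /pair_tgt /pair_comp /=.
  by congr (_, ccomp _ _); apply: Prop_irrelevance.
- move=> h k e e'; rewrite /= /pair_comp /=.
  by congr (_, ccomp _ _); apply: Prop_irrelevance.
- move=> a b c d eab ecd eac ebd e1 e2; rewrite /= /pair_comp /=.
  by congr (_, _); congr ccomp; apply: Prop_irrelevance.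
Defined.

Definition extprod_functor (A B C C' : category) (F : functor A B)
    (G : functor C C') : dblfunctor (extprod A C) (extprod B C') :=
  @DblFunctor (extprod A C) (extprod B C') _ _ _ _
    (is_functor_prod (is_functor_disc (fob F)) (functorP G))
    (is_functor_prod (functorP F) (is_functor_disc (fob G)))
    (is_functor_prod (is_functor_disc (fmor F)) (functorP G))
    (is_functor_prod (functorP F) (is_functor_disc (fmor G))).

(* A nondegenerate simplex of Delta[m] is a nonempty set of vertices in
   {0, ..., m}.  A chain of such simplices is encoded by the set of its
   terms. *)
Definition is_chain (m : nat) (c : {set {set 'I_m.+1}}) : bool :=
  [&& c != set0, set0 \notin c &
      [forall s in c, forall t in c, (s \subset t) || (t \subset s)]].

Definition chain (m : nat) : Type := {c : {set {set 'I_m.+1}} | is_chain c}.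

Definition chain_le (m : nat) : rel (chain m) :=
  fun c d => sval c \subset sval d.

Lemma chain_le_refl m : reflexive (@chain_le m).
Proof. by move=> c; apply: subxx. Qed.

Lemma chain_le_trans m : transitive (@chain_le m).
Proof. by move=> c d e; apply: subset_trans. Qed.

Definition cSd2_simplex (m : nat) : category :=
  preorder_cat (@chain_le_refl m) (@chain_le_trans m).

(* The horn is the union of the i-th faces of Delta[m] for i != k. *)
Definition horn_face (m : nat) (k : 'I_m.+1) (s : {set 'I_m.+1}) : bool :=
  [exists i, (i != k) && (i \notin s)].

Definition horn_chain (m : nat) (k : 'I_m.+1) : pred (chain m) :=
  fun c => [forall s in sval c, horn_face k s].

Definition walking_iso : category :=
  @preorder_cat bool (fun _ _ => true) (fun _ => erefl) (fun _ _ _ _ _ => erefl).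

(* The two inclusions A -> B under consideration: A is the full subcategory of
   [incl_cat j] on the objects satisfying [incl_pred j].  In the second case
   [true] plays the role of the object 1. *)
Inductive incl_case : Type :=
  | Horn (m : nat) (k : 'I_m.+1)
  | PointIso.

Definition incl_cat (j : incl_case) : category :=
  match j with
  | Horn m k => cSd2_simplex m
  | PointIso => walking_iso
  end.

Definition incl_pred (j : incl_case) : pred (Ob (incl_cat j)) :=
  match j return pred (Ob (incl_cat j)) with
  | Horn m k => @horn_chain m k
  | PointIso => fun x : bool => x == true
  end.
Arguments incl_pred : clear implicits.

Definition is_horn (j : incl_case) : bool :=
  if j is Horn _ _ then true else false.

Definition is_identity (O M : Type) (X : cat_on O M) (f : M) : Prop :=
  exists x : O, f = cid X x.

Definition is_comp3 (O M : Type) (X : cat_on O M) (f g h x : M) : Prop :=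
  exists (e1 : ctgt X f = csrc X g) (e2 : ctgt X (ccomp X e1) = csrc X h),
    x = ccomp X e2.

Section Description.
Variables (B : category) (A : pred (Ob B)) (C : category) (D P : dblcat).
Variables (F : dblfunctor (extprod (full_sub A) C) D).
Variables (u : dblfunctor D P) (v : dblfunctor (extprod B C) P).

Definition new_ob : Type := {b : Ob B | ~~ A b}.

Definition canonical_ob : dob D + new_ob * Ob C -> dob P :=
  sum_map (dfob u) (fun p => dfob v (sval p.1, p.2)).

Definition new_hfunctor :
  functor (prod_cat (disc new_ob) C) (hcategory (extprod B C)) :=
  @Functor (prod_cat (disc new_ob) C) (hcategory (extprod B C)) _ _
    (is_functor_prod (is_functor_disc sval) (is_functor_id C)).

Definition canonical_hfunctor :
  functor (coprod_cat (hcategory D) (prod_cat (disc new_ob) C)) (hcategory P) :=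
  copair (hfunctor u) (functor_comp new_hfunctor (hfunctor v)).

Definition new_vmor (x : vmor P) : Prop :=
  exists (f : Mor B) (c : Ob C), ~~ sub_mor A f /\ x = dfv v (f, c).

Definition new_sq (x : sq P) : Prop :=
  exists (f : Mor B) (g : Mor C), ~~ sub_mor A f /\ x = dfsq v (f, g).

Definition vpath (f1 : vmor P) (d : vmor D) (f2 x : vmor P) : Prop :=
  [/\ is_identity (vcat P) f1 \/ new_vmor f1,
      is_identity (vcat P) f2 \/ new_vmor f2
    & is_comp3 (vcat P) f1 (dfv u d) f2 x].

Definition enters_at (f1 : vmor P) (x : dob D) : Prop :=
  exists (f : Mor B) (a : Ob (full_sub A)) (c : Ob C),
    [/\ ~~ sub_mor A f, ~~ A (csrc B f), ctgt B f = sval a,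
        f1 = dfv v (f, c) & x = dfob F (a, c)].

Definition leaves_at (f2 : vmor P) (x : dob D) : Prop :=
  exists (f : Mor B) (a : Ob (full_sub A)) (c : Ob C),
    [/\ ~~ sub_mor A f, ~~ A (ctgt B f), csrc B f = sval a,
        f2 = dfv v (f, c) & x = dfob F (a, c)].

Definition vsq_path (b1 : sq P) (d : sq D) (b2 x : sq P) : Prop :=
  [/\ is_identity (vsq P) b1 \/ new_sq b1,
      is_identity (vsq P) b2 \/ new_sq b2
    & is_comp3 (vsq P) b1 (dfsq u d) b2 x].
End Description.
Arguments canonical_ob {B} A {C D P} u v _.

(* Main.v *)
(* Sending a double category to its category of objects and horizontal
   morphisms, or of objects and vertical morphisms, has a right adjoint, hence
   preserves pushouts.  Horizontally the pushout is that of
   [disc A0 * C -> disc B0 * C], which is the asserted coproduct.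

   The morphisms and squares of [P] that are vertical composites of images of
   [D] and of [B x C] form a double subcategory, which is all of [P] by the
   universal property.  This needs closure under horizontal composition of
   squares, where intermediate objects of two factorisations may differ: an
   object [b] below which there are objects of [A] has a coreflection
   [pi b -> b], and factorisations are normalised to pass through it.  The
   middle parts of two adjacent normalised squares are then composable in [D]:
   they have the same image under a functor on the vertical morphisms of [P]
   which sends the coreflections to identities and is injective on those of
   [D]; it takes values in the vertical category of [D] with a new initial
   object, the image of the objects [b] without coreflection. *)

From mathcomp Require Import ssreflect ssrfun ssrbool eqtype ssrnat fintype.
From mathcomp Require Import finset boolp.
Require Import Defs.

Set Implicit Arguments.
Unset Strict Implicit.
Unset Printing Implicit Defensive.

(** * Total composition and the laws of a double category *)

(* Composition made total, with the junk value [f] on non-composable pairs. *)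
Definition tcomp (O M : Type) (X : cat_on O M) (f g : M) : M :=
  match pselect (ctgt X f = csrc X g) with
  | left e => ccomp X e
  | right _ => f
  end.

Section TotalComposition.
Variables (O M : Type) (X : cat_on O M).
Local Notation "f ;; g" := (tcomp X f g) (at level 47, right associativity).

(** Proof irrelevance makes the two compositions agree. Rewriting with this turns the laws into
    equations between terms free of composability proofs. *)
Lemma tcompE (f g : M) (e : ctgt X f = csrc X g) : ccomp X e = f ;; g.
Proof.
by rewrite /tcomp; case: pselect => // e'; congr ccomp; apply: Prop_irrelevance.
Qed.

Lemma csrc_tcomp (f g : M) : csrc X (f ;; g) = csrc X f.
Proof. by rewrite /tcomp; case: pselect => // e; rewrite csrc_comp. Qed.

Lemma ctgt_tcomp (f g : M) :
  ctgt X f = csrc X g -> ctgt X (f ;; g) = ctgt X g.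
Proof. by move=> e; rewrite -(tcompE e) ctgt_comp. Qed.

Lemma tcomp_idl (f : M) : cid X (csrc X f) ;; f = f.
Proof. by rewrite -(tcompE (ctgt_id X _)) ccomp_idl. Qed.

Lemma tcomp_idr (f : M) : f ;; cid X (ctgt X f) = f.
Proof. by rewrite -(tcompE (esym (csrc_id X _))) ccomp_idr. Qed.

Lemma tcomp_idl_at (x : O) (f : M) : x = csrc X f -> cid X x ;; f = f.
Proof. by move=> ->; apply: tcomp_idl. Qed.

Lemma tcomp_idr_at (x : O) (f : M) : ctgt X f = x -> f ;; cid X x = f.
Proof. by move=> <-; apply: tcomp_idr. Qed.

Lemma tcompA (f g h : M) :
  ctgt X f = csrc X g -> ctgt X g = csrc X h -> (f ;; g) ;; h = f ;; (g ;; h).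
Proof.
move=> e1 e2; have e3 : ctgt X (f ;; g) = csrc X h by rewrite ctgt_tcomp.
have e4 : ctgt X f = csrc X (g ;; h) by rewrite csrc_tcomp.
move: e3 e4; rewrite -(tcompE e1) -(tcompE e2) => e3 e4.
by rewrite -(tcompE e3) -(tcompE e4); apply: ccompA.
Qed.
End TotalComposition.

Lemma fun_tcomp (O M O' M' : Type) (X : cat_on O M) (Y : cat_on O' M') fo fm :
  is_functor X Y fo fm -> forall f g, ctgt X f = csrc X g ->
  fm (tcomp X f g) = tcomp Y (fm f) (fm g).
Proof.
move=> hF f g e; have e' : ctgt Y (fm f) = csrc Y (fm g).
  by rewrite (fun_tgt hF) (fun_src hF) e.
by rewrite -(tcompE e) -(tcompE e') (fun_comp hF).
Qed.

Lemma prod_tcomp (O M O' M' : Type) (X : cat_on O M) (Y : cat_on O' M') f g :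
  ctgt X f.1 = csrc X g.1 -> ctgt Y f.2 = csrc Y g.2 ->
  tcomp (prod_on X Y) f g = (tcomp X f.1 g.1, tcomp Y f.2 g.2).
Proof.
case: f g => [f f'] [g g'] /= e e'.
have ee : pair_tgt X Y (f, f') = pair_src X Y (g, g').
  by rewrite /pair_tgt /pair_src /= e e'.
rewrite -(@tcompE _ _ (prod_on X Y) _ _ ee) /= /pair_comp /=.
by rewrite !tcompE.
Qed.

Lemma disc_tcomp (S : Type) (x y : S) : tcomp (disc_on S) x y = x.
Proof. by rewrite /tcomp; case: pselect. Qed.

Lemma is_functor_tcomp (O M O' M' : Type) (X : cat_on O M) (Y : cat_on O' M')
    fo fm :
  (forall f, csrc Y (fm f) = fo (csrc X f)) ->
  (forall f, ctgt Y (fm f) = fo (ctgt X f)) ->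
  (forall x, fm (cid X x) = cid Y (fo x)) ->
  (forall f g, ctgt X f = csrc X g -> fm (tcomp X f g) = tcomp Y (fm f) (fm g)) ->
  is_functor X Y fo fm.
Proof. by move=> hs ht hi hc; split=> // f g e e'; rewrite !tcompE hc. Qed.

Section DoubleCategory.
Variable P : dblcat.

Lemma src_left (a : sq P) :
  csrc (vcat P) (csrc (hsq P) a) = csrc (hcat P) (csrc (vsq P) a).
Proof. exact: fun_src (left_functor P) a. Qed.
Lemma tgt_left (a : sq P) :
  ctgt (vcat P) (csrc (hsq P) a) = csrc (hcat P) (ctgt (vsq P) a).
Proof. exact: fun_tgt (left_functor P) a. Qed.
Lemma src_right (a : sq P) :
  csrc (vcat P) (ctgt (hsq P) a) = ctgt (hcat P) (csrc (vsq P) a).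
Proof. exact: fun_src (right_functor P) a. Qed.
Lemma tgt_right (a : sq P) :
  ctgt (vcat P) (ctgt (hsq P) a) = ctgt (hcat P) (ctgt (vsq P) a).
Proof. exact: fun_tgt (right_functor P) a. Qed.

Lemma tops_composable (a b : sq P) : ctgt (hsq P) a = csrc (hsq P) b ->
  ctgt (hcat P) (csrc (vsq P) a) = csrc (hcat P) (csrc (vsq P) b).
Proof. by rewrite -src_left -src_right => ->. Qed.

Lemma bots_composable (a b : sq P) : ctgt (hsq P) a = csrc (hsq P) b ->
  ctgt (hcat P) (ctgt (vsq P) a) = csrc (hcat P) (ctgt (vsq P) b).
Proof. by rewrite -tgt_left -tgt_right => ->. Qed.

Lemma top_tcomp (a b : sq P) : ctgt (hsq P) a = csrc (hsq P) b ->
  csrc (vsq P) (tcomp (hsq P) a b) =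
  tcomp (hcat P) (csrc (vsq P) a) (csrc (vsq P) b).
Proof.
move=> e; rewrite -(tcompE e) -(tcompE (tops_composable e)).
exact: top_hcomp.
Qed.

Lemma bot_tcomp (a b : sq P) : ctgt (hsq P) a = csrc (hsq P) b ->
  ctgt (vsq P) (tcomp (hsq P) a b) =
  tcomp (hcat P) (ctgt (vsq P) a) (ctgt (vsq P) b).
Proof.
move=> e; rewrite -(tcompE e) -(tcompE (bots_composable e)).
exact: bot_hcomp.
Qed.

Lemma vid_tcomp (h k : hmor P) : ctgt (hcat P) h = csrc (hcat P) k ->
  cid (vsq P) (tcomp (hcat P) h k) =
  tcomp (hsq P) (cid (vsq P) h) (cid (vsq P) k).
Proof.
move=> e; have e' : ctgt (hsq P) (cid (vsq P) h) = csrc (hsq P) (cid (vsq P) k).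
  by rewrite (fun_id (right_functor P)) (fun_id (left_functor P)) e.
by rewrite -(tcompE e) -(tcompE e'); apply: vid_hcomp.
Qed.

Lemma tinterchange (a b c d : sq P) :
  ctgt (hsq P) a = csrc (hsq P) b -> ctgt (hsq P) c = csrc (hsq P) d ->
  ctgt (vsq P) a = csrc (vsq P) c -> ctgt (vsq P) b = csrc (vsq P) d ->
  tcomp (vsq P) (tcomp (hsq P) a b) (tcomp (hsq P) c d) =
  tcomp (hsq P) (tcomp (vsq P) a c) (tcomp (vsq P) b d).
Proof.
move=> eab ecd eac ebd.
have e1 : ctgt (vsq P) (ccomp _ eab) = csrc (vsq P) (ccomp _ ecd).
  by rewrite !tcompE bot_tcomp // top_tcomp // eac ebd.
have e2 : ctgt (hsq P) (ccomp _ eac) = csrc (hsq P) (ccomp _ ebd).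
  rewrite !tcompE (fun_tcomp (right_functor P)) //.
  rewrite (fun_tcomp (left_functor P)) //.
  by rewrite eab ecd.
by have := interchange e1 e2; rewrite !tcompE.
Qed.
End DoubleCategory.

(** * Codiscrete double categories *)

Definition codisc_on (S : Type) : cat_on S (S * S).
Proof.
refine (@CatOn _ _ fst snd (fun x => (x, x)) (fun f g _ => (f.1, g.2))
  _ _ _ _ _ _ _) => //.
- by case.
- by case.
Defined.

Lemma codisc_tcomp (S : Type) (p q : S * S) :
  p.2 = q.1 -> tcomp (codisc_on S) p q = (p.1, q.2).
Proof. by move=> e; rewrite -(@tcompE _ _ (codisc_on S) _ _ e). Qed.

Lemma is_functor_codisc (O M O' : Type) (X : cat_on O M) (fo : O -> O') :
  is_functor X (codisc_on O') fo (fun f => (fo (csrc X f), fo (ctgt X f))).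
Proof.
apply: is_functor_tcomp => //=.
- by move=> x; rewrite csrc_id ctgt_id.
- by move=> f g e; rewrite codisc_tcomp /= ?e // csrc_tcomp ctgt_tcomp.
Qed.

(* The right adjoint of [hcategory]: squares are arbitrary pairs of a top and a
   bottom morphism, so that double functors into [hcodisc H] are functors into
   [H].  Below, [vcodisc] plays the same role for [vcategory]. *)
Definition hcodisc (H : category) : dblcat.
Proof.
refine (@DblCat (Ob H) (Mor H) (Ob H * Ob H) (Mor H * Mor H)
  H (codisc_on (Ob H)) (prod_on H H) (codisc_on (Mor H)) _ _ _ _ _ _ _) => /=.
- exact: (is_functor_codisc (codisc_on (Mor H))).
- exact: (is_functor_codisc (codisc_on (Mor H))).
- by split=> //= f g e e'; rewrite /pair_comp !tcompE.
- by move=> a b e e'; rewrite !tcompE.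
- by move=> a b e e'; rewrite !tcompE.
- by move=> a b e e'; rewrite /pair_comp !tcompE.
- by move=> a b c d eab ecd eac ebd e1 e2; rewrite /pair_comp !tcompE.
Defined.

Definition vcodisc (V : category) : dblcat.
Proof.
refine (@DblCat (Ob V) (Ob V * Ob V) (Mor V) (Mor V * Mor V)
  (codisc_on (Ob V)) V (codisc_on (Mor V)) (prod_on V V) _ _ _ _ _ _ _) => /=.
- by split=> //= f g e e'; rewrite /pair_comp !tcompE.
- by split=> //= f g e e'; rewrite /pair_comp !tcompE.
- by split=> //= f g e e'; rewrite /pair_comp !tcompE.
- by [].
- by [].
- by [].
- by move=> a b c d eab ecd eac ebd e1 e2; rewrite /pair_comp !tcompE.
Defined.

Lemma is_functor_pair (O M O1 M1 O2 M2 : Type) (X : cat_on O M)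
    (X1 : cat_on O1 M1) (X2 : cat_on O2 M2) fo fm go gm :
  is_functor X X1 fo fm -> is_functor X X2 go gm ->
  is_functor X (prod_on X1 X2) (fun x => (fo x, go x)) (fun f => (fm f, gm f)).
Proof.
move=> hf hg; apply: is_functor_tcomp => /=.
- by move=> f; rewrite /pair_src /= (fun_src hf) (fun_src hg).
- by move=> f; rewrite /pair_tgt /= (fun_tgt hf) (fun_tgt hg).
- by move=> x; rewrite (fun_id hf) (fun_id hg).
- move=> f g e; rewrite (fun_tcomp hf) // (fun_tcomp hg) // prod_tcomp //=.
    by rewrite (fun_tgt hf) (fun_src hf) e.
  by rewrite (fun_tgt hg) (fun_src hg) e.
Qed.

(** The transpose of [G] under the adjunction with [hcategory]. *)
Definition to_hcodisc (E : dblcat) (H : category)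
  (G : functor (hcategory E) H) : dblfunctor E (hcodisc H).
Proof.
refine (@DblFunctor E (hcodisc H) (fob G) (fmor G)
  (fun f => (fob G (csrc (vcat E) f), fob G (ctgt (vcat E) f)))
  (fun a => (fmor G (csrc (vsq E) a), fmor G (ctgt (vsq E) a))) _ _ _ _).
- exact: (functorP G).
- exact: is_functor_codisc.
- have hG := functorP G.
  apply: is_functor_tcomp => /=.
  + by move=> f; rewrite /pair_src /= !(fun_src hG) /= src_left tgt_left.
  + by move=> f; rewrite /pair_tgt /= !(fun_tgt hG) /= src_right tgt_right.
  + move=> x; have h := hid_functor E.
    by rewrite (fun_src h) (fun_tgt h) !(fun_id hG).
  + move=> f g e; have e1 := tops_composable e; have e2 := bots_composable e.
    rewrite top_tcomp // bot_tcomp // !(fun_tcomp hG) // prod_tcomp //=.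
      by rewrite (fun_tgt hG) (fun_src hG) /= e1.
    by rewrite (fun_tgt hG) (fun_src hG) /= e2.
- exact: is_functor_codisc.
Defined.

Definition vcategory (D : dblcat) : category := Category (vcat D).

Definition to_vcodisc (E : dblcat) (V : category)
  (G : functor (vcategory E) V) : dblfunctor E (vcodisc V).
Proof.
refine (@DblFunctor E (vcodisc V) (fob G)
  (fun h => (fob G (csrc (hcat E) h), fob G (ctgt (hcat E) h))) (fmor G)
  (fun a => (fmor G (csrc (hsq E) a), fmor G (ctgt (hsq E) a))) _ _ _ _).
- exact: is_functor_codisc.
- exact: (functorP G).
- exact: is_functor_codisc.
- have h1 := is_functor_comp (left_functor E) (functorP G).
  have h2 := is_functor_comp (right_functor E) (functorP G).
  exact: is_functor_pair h1 h2.
Defined.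

(** Vertical morphisms and squares of [hcodisc H] are determined by their vertical boundaries. This
    is the uniqueness half of the adjunction. *)
Lemma hcodisc_ext (E : dblcat) (H : category) (K L : dblfunctor E (hcodisc H)) :
  dfob K =1 dfob L -> dfh K =1 dfh L -> dblfunctor_eq K L.
Proof.
move=> eo eh; split=> // x.
- rewrite (surjective_pairing (dfv K x)) (surjective_pairing (dfv L x)).
  have [sK tK] := (fun_src (df_vcat K) x, fun_tgt (df_vcat K) x).
  have [sL tL] := (fun_src (df_vcat L) x, fun_tgt (df_vcat L) x).
  by move: sK tK sL tL => /= -> -> -> ->; rewrite !eo.
- rewrite (surjective_pairing (dfsq K x)) (surjective_pairing (dfsq L x)).
  have [sK tK] := (fun_src (df_vsq K) x, fun_tgt (df_vsq K) x).
  have [sL tL] := (fun_src (df_vsq L) x, fun_tgt (df_vsq L) x).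
  by move: sK tK sL tL => /= -> -> -> ->; rewrite !eh.
Qed.

Lemma vcodisc_ext (E : dblcat) (V : category) (K L : dblfunctor E (vcodisc V)) :
  dfob K =1 dfob L -> dfv K =1 dfv L -> dblfunctor_eq K L.
Proof.
move=> eo ev; split=> // x.
- rewrite (surjective_pairing (dfh K x)) (surjective_pairing (dfh L x)).
  have [sK tK] := (fun_src (df_hcat K) x, fun_tgt (df_hcat K) x).
  have [sL tL] := (fun_src (df_hcat L) x, fun_tgt (df_hcat L) x).
  by move: sK tK sL tL => /= -> -> -> ->; rewrite !eo.
- rewrite (surjective_pairing (dfsq K x)) (surjective_pairing (dfsq L x)).
  have [sK tK] := (fun_src (df_hsq K) x, fun_tgt (df_hsq K) x).
  have [sL tL] := (fun_src (df_hsq L) x, fun_tgt (df_hsq L) x).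
  by move: sK tK sL tL => /= -> -> -> ->; rewrite !ev.
Qed.

(** * Functors out of a pushout *)

Definition vfunctor (D E : dblcat) (F : dblfunctor D E) :
  functor (vcategory D) (vcategory E) :=
  @Functor (vcategory D) (vcategory E) _ _ (df_vcat F).

Section PushoutFunctors.
Variables (S D E P : dblcat) (F : dblfunctor S D) (G : dblfunctor S E).
Variables (u : dblfunctor D P) (v : dblfunctor E P).
Hypothesis hP : is_pushout F G u v.

(** Transposition turns a cocone of functors into [H] into a cocone of double functors into
    [hcodisc H], and the mediating double functor restricts to [w]. *)
Lemma pushout_hfunctor (H : category) (s : functor (hcategory D) H)
    (t : functor (hcategory E) H) :
  functor_eq (functor_comp (hfunctor F) s) (functor_comp (hfunctor G) t) ->
  exists w : functor (hcategory P) H,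
    functor_eq (functor_comp (hfunctor u) w) s /\
    functor_eq (functor_comp (hfunctor v) w) t.
Proof.
case=> eo em.
have [|w [[[wuo wuh _ _] [wvo wvh _ _]] _]] :=
    hP.2 _ (to_hcodisc s) (to_hcodisc t).
  by apply: hcodisc_ext.
by exists (@Functor (hcategory P) H _ _ (df_hcat w)).
Qed.

Lemma pushout_vfunctor (V : category) (s : functor (vcategory D) V)
    (t : functor (vcategory E) V) :
  functor_eq (functor_comp (vfunctor F) s) (functor_comp (vfunctor G) t) ->
  exists w : functor (vcategory P) V,
    functor_eq (functor_comp (vfunctor u) w) s /\
    functor_eq (functor_comp (vfunctor v) w) t.
Proof.
case=> eo em.
have [|w [[[wuo _ wuv _] [wvo _ wvv _]] _]] :=
    hP.2 _ (to_vcodisc s) (to_vcodisc t).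
  by apply: vcodisc_ext.
by exists (@Functor (vcategory P) V _ _ (df_vcat w)).
Qed.

(** Both [w] and [w'] mediate the cocone obtained from [w'], so each agrees with the mediating
    double functor [w0]. *)
Lemma pushout_unique (X : dblcat) (w w' : dblfunctor P X) :
  dblfunctor_eq (dblfunctor_comp u w) (dblfunctor_comp u w') ->
  dblfunctor_eq (dblfunctor_comp v w) (dblfunctor_comp v w') ->
  dblfunctor_eq w w'.
Proof.
move=> eu ev; have [ho hh hv hs] := hP.1.
have := hP.2 _ (dblfunctor_comp u w') (dblfunctor_comp v w').
case.
  by split=> x /=; congr (_ w' _);
    [apply: ho | apply: hh | apply: hv | apply: hs].
move=> w0 [_ h0]; have [o h a b] := h0 _ eu ev.
have [|//|o' h' a' b'] := h0 w' => //.
by split=> x; rewrite ?o ?h ?a ?b ?o' ?h' ?a' ?b'.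
Qed.

Lemma pushout_hfunctor_unique (H : category) (w w' : functor (hcategory P) H) :
  functor_eq (functor_comp (hfunctor u) w) (functor_comp (hfunctor u) w') ->
  functor_eq (functor_comp (hfunctor v) w) (functor_comp (hfunctor v) w') ->
  functor_eq w w'.
Proof.
move=> [uo um] [vo vm].
have [] := @pushout_unique _ (to_hcodisc w) (to_hcodisc w') => //.
- exact: hcodisc_ext.
- exact: hcodisc_ext.
Qed.
End PushoutFunctors.

(** * Objects and horizontal morphisms of the pushout *)

Section Part.
Variables (T : Type) (A : pred T).

(** The proof of [A b] or of its negation is kept, because a cocone defined by cases has to produce
    elements of the two subtypes. *)
Definition part (b : T) : {x | A x} + {x | ~~ A x} :=
  match Sumbool.sumbool_of_bool (A b) with
  | left h => inl (exist _ b h)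
  | right h => inr (exist _ b (negbT h))
  end.

Lemma part_old (a : {x | A x}) : part (sval a) = inl a.
Proof.
rewrite /part; case: Sumbool.sumbool_of_bool; case: a => b hb /= h.
  by congr (inl (exist _ _ _)); apply: Prop_irrelevance.
by exfalso; rewrite hb in h.
Qed.

Lemma part_new (a : {x | ~~ A x}) : part (sval a) = inr a.
Proof.
rewrite /part; case: Sumbool.sumbool_of_bool; case: a => b hb /= h.
  by exfalso; rewrite h in hb.
by congr (inr (exist _ _ _)); apply: Prop_irrelevance.
Qed.

Lemma part_case (b : T) (Q : T -> Prop) :
  (forall a : {x | A x}, Q (sval a)) -> (forall n : {x | ~~ A x}, Q (sval n)) ->
  Q b.
Proof.
move=> h1 h2; case hb: (A b); first exact: (h1 (exist _ b hb)).
exact: (h2 (exist _ b (negbT hb))).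
Qed.
End Part.

Lemma is_functor_inl (A B : category) :
  is_functor A (sum_on A B) inl inl.
Proof.
split=> // f g e e' /=; congr (inl (ccomp _ _)); exact: Prop_irrelevance.
Qed.

Lemma is_functor_inr (A B : category) :
  is_functor B (sum_on A B) inr inr.
Proof.
split=> // f g e e' /=; congr (inr (ccomp _ _)); exact: Prop_irrelevance.
Qed.

Section HorizontalPart.
Variables (B : category) (A : pred (Ob B)) (C : category) (D P : dblcat).
Variables (F : dblfunctor (extprod (full_sub A) C) D).
Variables (u : dblfunctor D P) (v : dblfunctor (extprod B C) P).
Hypothesis hP :
  is_pushout F (extprod_functor (full_incl A) (functor_id C)) u v.

Let H := coprod_cat (hcategory D) (prod_cat (disc (new_ob A)) C).

(** The leg from [extprod B C] of a cocone over the coproduct [H], whose other leg is the left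
    injection: what lies over [A] is moved into [D] by [F]. *)
Definition split_ob (x : Ob B * Ob C) : Ob H :=
  match part A x.1 with
  | inl a => inl (dfob F (a, x.2))
  | inr n => inr (n, x.2)
  end.

Definition split_hmor (x : Ob B * Mor C) : Mor H :=
  match part A x.1 with
  | inl a => inl (dfh F (a, x.2))
  | inr n => inr (n, x.2)
  end.

(** The first coordinate is discrete, so composable arrows lie over the same object of [B] and one
    case distinction settles both. *)
Lemma is_functor_split :
  is_functor (hcat (extprod B C)) H split_ob split_hmor.
Proof.
have hF := is_functor_comp (df_hcat F)
  (is_functor_inl (hcategory D) (prod_cat (disc (new_ob A)) C)).
have hI := is_functor_inr (hcategory D) (prod_cat (disc (new_ob A)) C).
apply: is_functor_tcomp => /=.
- case=> b g; rewrite /split_ob /split_hmor /=; case: (part A b) => a //=.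
  by rewrite (fun_src (df_hcat F)).
- case=> b g; rewrite /split_ob /split_hmor /=; case: (part A b) => a //=.
  by rewrite (fun_tgt (df_hcat F)).
- case=> b g; rewrite /split_ob /split_hmor /=; case: (part A b) => a //=.
  by rewrite -(fun_id (df_hcat F)).
- case=> b g [b' g'] /=; rewrite /pair_tgt /pair_src /= => -[<- e].
  rewrite prod_tcomp //= disc_tcomp /split_hmor /=.
  case: (part A b) => a /=.
  + have e' : ctgt (prod_on (disc_on {x | A x}) C) (a, g) =
              csrc (prod_on (disc_on {x | A x}) C) (a, g').
      by rewrite /= /pair_tgt /pair_src /= e.
    by rewrite -(fun_tcomp hF e') prod_tcomp //= disc_tcomp.
  + have e' : ctgt (prod_on (disc_on (new_ob A)) C) (a, g) =
              csrc (prod_on (disc_on (new_ob A)) C) (a, g').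
      by rewrite /= /pair_tgt /pair_src /= e.
    by rewrite -(fun_tcomp hI e') prod_tcomp //= disc_tcomp.
Qed.

(** The inverse is the functor [w] mediating the left injection and the splitting. One composite is
    computed on the two summands; the other is the identity because it is so after [u] and after
    [v]. *)
Lemma pushout_hcategory : is_iso_functor (canonical_hfunctor A u v).
Proof.
have [ho hh _ _] := hP.1.
pose s := @Functor (hcategory D) H _ _ (is_functor_inl _ _).
pose t := @Functor (hcategory (extprod B C)) H _ _ is_functor_split.
have [|w [[wuo wuh] [wvo wvh]]] := @pushout_hfunctor _ _ _ _ _ _ _ _ hP H s t.
  by split=> -[a c]; rewrite /= /split_ob /split_hmor /= part_old.
exists w; split; first split.
- by case=> [x|[n c]]; rewrite /= ?[LHS]wuo ?[LHS]wvo //= /split_ob part_new.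
- by case=> [x|[n c]]; rewrite /= ?[LHS]wuh ?[LHS]wvh //= /split_hmor part_new.
apply: (pushout_hfunctor_unique hP); split.
- by move=> x; rewrite /= [fob w _]wuo.
- by move=> x; rewrite /= [fmor w _]wuh.
- case=> b c /=; rewrite [fob w _]wvo /= /split_ob /=.
  by elim/(@part_case _ A): b => a; rewrite ?part_old ?part_new //; apply: ho (a, c).
- case=> b c /=; rewrite [fmor w _]wvh /= /split_hmor /=.
  by elim/(@part_case _ A): b => a; rewrite ?part_old ?part_new //; apply: hh (a, c).
Qed.

Lemma pushout_objects : bijective (canonical_ob A u v).
Proof. by have [G [[h _] [h' _]]] := pushout_hcategory; exists (fob G). Qed.

(** For squares under vertical composition the horizontal morphisms play the role of objects, and
    this is the injectivity on objects for them. *)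
Lemma pushout_hmor_inj :
  injective (sum_map (dfh u) (fun p : new_ob A * Mor C => dfh v (sval p.1, p.2))).
Proof.
have [G [[_ h] _]] := pushout_hcategory => x y e.
by rewrite -[x]h -[y]h /=; congr (fmor G _). Qed.
End HorizontalPart.

(** * Factorisations of vertical composites *)

Section Cone.
Variables (O M : Type) (X : cat_on O M).

Definition cone_src (f : (M + O) + unit) : O + unit :=
  match f with
  | inl (inl m) => inl (csrc X m)
  | inl (inr _) => inr tt
  | inr _ => inr tt
  end.
Definition cone_tgt (f : (M + O) + unit) : O + unit :=
  match f with
  | inl (inl m) => inl (ctgt X m)
  | inl (inr x) => inl x
  | inr _ => inr tt
  end.
Definition cone_id (x : O + unit) : (M + O) + unit :=
  match x with inl a => inl (inl (cid X a)) | inr _ => inr tt end.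
(** Only non-composable pairs reach the last clause. *)
Definition cone_comp (f g : (M + O) + unit) : (M + O) + unit :=
  match f, g with
  | inr _, _ => g
  | inl (inl m), inl (inl n) => inl (inl (tcomp X m n))
  | inl (inr _), inl (inl n) => inl (inr (ctgt X n))
  | _, _ => f
  end.

(* [X] with a new initial object [inr tt]; the morphism from it to [x] is
   [inl (inr x)]. *)
Definition cone_on : cat_on (O + unit) ((M + O) + unit).
Proof.
refine (@CatOn _ _ cone_src cone_tgt cone_id (fun f g _ => cone_comp f g)
  _ _ _ _ _ _ _).
- by case=> [x|[]] //=; rewrite csrc_id.
- by case=> [x|[]] //=; rewrite ctgt_id.
- case=> [[m|x]|[]] [[n|y]|[]] //= _.
  by rewrite csrc_tcomp.
- by case=> [[m|x]|[]] [[n|y]|[]] //= [e]; rewrite ctgt_tcomp.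
- by case=> [[m|x]|[]] //= _; rewrite tcomp_idl.
- by case=> [[m|x]|[]] //= _; rewrite ?tcomp_idr // ctgt_id.
- case=> [[m|x]|[]] [[n|y]|[]] [[p|z]|[]] //= e1 e2 _ _.
    by case: e1 e2 => e1 [e2]; rewrite tcompA.
  by case: e2 => e2; rewrite ctgt_tcomp.
Defined.

Lemma cone_tcomp f g : ctgt cone_on f = csrc cone_on g ->
  tcomp cone_on f g = cone_comp f g.
Proof. by move=> e; rewrite -(tcompE e). Qed.

Lemma is_functor_cone_inl : is_functor X cone_on inl (inl \o inl).
Proof.
apply: is_functor_tcomp => //= f g e; rewrite cone_tcomp //=.
by rewrite e.
Qed.
End Cone.

Definition cone (X : category) : category := Category (cone_on X).

Definition thin (X : category) : Prop := forall f g : Mor X,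
  csrc X f = csrc X g -> ctgt X f = ctgt X g -> f = g.

(** * Normal forms of generated morphisms *)

Section GeneratedMorphisms.
Variables (B : category) (A : pred (Ob B)).
Hypothesis thinB : thin B.
(** A partial coreflection: [fob R b] is [inl a] exactly when [b] receives an arrow from [A], and
    then [a] is its coreflection [pi b]. *)
Variable R : functor B (cone (full_sub A)).
Hypothesis R_old : forall a, fob R (sval a) = inl a.
Hypothesis counit : forall b a, fob R b = inl a ->
  exists f, csrc B f = sval a /\ ctgt B f = b.
Hypothesis to_old : forall f, A (ctgt B f) -> exists a g,
  [/\ fob R (csrc B f) = inl a, csrc B g = csrc B f & ctgt B g = sval a].

(** The situation is abstracted from the pushout in order to be used twice: [K] is [Ob C] for
    vertical morphisms, and [Mor C] for squares under vertical composition. *)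
Variables (K O M OD MD : Type) (P : cat_on O M) (Y : cat_on OD MD).
Variables (Fo : {b | A b} * K -> OD) (Fm : {f | sub_mor A f} * K -> MD).
Variables (uo : OD -> O) (um : MD -> M) (vo : Ob B * K -> O) (vm : Mor B * K -> M).
Hypothesis hF : is_functor (prod_on (full_sub A) (disc_on K)) Y Fo Fm.
Hypothesis hu : is_functor Y P uo um.
Hypothesis hv : is_functor (prod_on B (disc_on K)) P vo vm.
Hypothesis ho : forall a k, uo (Fo (a, k)) = vo (sval a, k).
Hypothesis hm : forall f k, um (Fm (f, k)) = vm (sval f, k).
Hypothesis inj_ob :
  injective (sum_map uo (fun p : new_ob A * K => vo (sval p.1, p.2))).

Local Notation "f ;; g" := (tcomp P f g) (at level 47, right associativity).
Local Notation src := (csrc P).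
Local Notation tgt := (ctgt P).

Lemma thin_sub : thin (full_sub A).
Proof.
move=> f g es et; apply: val_inj; apply: thinB.
  exact: (congr1 sval es).
exact: (congr1 sval et).
Qed.

(** In the cone, an arrow that starts at an old object also ends at one and is an old arrow. *)
Lemma R_from_old f : A (csrc B f) ->
  exists m : Mor (full_sub A), fmor R f = inl (inl m) /\ sval (sub_src m) = csrc B f.
Proof.
move=> ha; have := fun_src (functorP R) f.
have := R_old (exist _ (csrc B f) ha); rewrite /= => ->.
case: (fmor R f) => [[m|x]|x] //= [e].
by exists m; split=> //; rewrite e.
Qed.

(** The universal property of the coreflection: [m] is the image of [f] under [R], [g] is the counit
    at the target of [f], and thinness gives the equation. *)
Lemma through_counit f : A (csrc B f) -> exists (m : Mor (full_sub A)) g,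
  [/\ f = tcomp B (sval m) g, ctgt B (sval m) = csrc B g,
      csrc B (sval m) = csrc B f,
      ctgt B f = ctgt B g & fob R (ctgt B f) = inl (sub_tgt m)].
Proof.
move=> ha; have [m [em sm]] := R_from_old ha.
have := fun_tgt (functorP R) f; rewrite em /= => /esym rt.
have [g [gs gt]] := counit rt; exists m, g; split=> //.
apply: thinB; first by rewrite csrc_tcomp.
by rewrite ctgt_tcomp.
Qed.

Lemma uo_inj : injective uo.
Proof. by move=> x y e; have [] := @inj_ob (inl x) (inl y) e. Qed.

Lemma vo_new (b : Ob B) k y : ~~ A b -> vo (b, k) <> uo y.
Proof.
by move=> hb e; have := @inj_ob (inr (exist _ b hb, k)) (inl y) e.
Qed.

Lemma vo_old b k y : vo (b, k) = uo y -> A b.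
Proof. by move=> e; apply: contraT => hb; case: (vo_new hb e). Qed.

Lemma vo_inj b k b' k' : ~~ A b -> vo (b, k) = vo (b', k') -> b = b' /\ k = k'.
Proof.
move=> hb; elim/(@part_case _ A): b' => a e.
  by case: (@vo_new b k (Fo (a, k')) hb); rewrite ho.
by have [<- <-] := @inj_ob (inr (exist _ b hb, k)) (inr (a, k')) e.
Qed.

Lemma src_u d : src (um d) = uo (csrc Y d). Proof. exact: (fun_src hu). Qed.
Lemma tgt_u d : tgt (um d) = uo (ctgt Y d). Proof. exact: (fun_tgt hu). Qed.
Lemma src_v f k : src (vm (f, k)) = vo (csrc B f, k).
Proof. exact: (fun_src hv). Qed.
Lemma tgt_v f k : tgt (vm (f, k)) = vo (ctgt B f, k).
Proof. exact: (fun_tgt hv). Qed.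
Lemma vm_comp f g k : ctgt B f = csrc B g ->
  vm (tcomp B f g, k) = vm (f, k) ;; vm (g, k).
Proof.
move=> e; rewrite -(fun_tcomp hv) /=; last by rewrite /pair_tgt /pair_src /= e.
by rewrite prod_tcomp // disc_tcomp.
Qed.
Lemma um_comp d e : ctgt Y d = csrc Y e -> um (tcomp Y d e) = um d ;; um e.
Proof. exact: (fun_tcomp hu). Qed.
Lemma vm_old f k (hf : sub_mor A f) : vm (f, k) = um (Fm (exist _ f hf, k)).
Proof. by rewrite hm. Qed.

Inductive Gen : M -> Prop :=
  | Gen_u d : Gen (um d)
  | Gen_v f k : Gen (vm (f, k))
  | Gen_comp f g : Gen f -> Gen g -> tgt f = src g -> Gen (f ;; g).

(* The canonical first factor [p] and last factor [m] of a composite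
   [p ;; um d ;; m]: an identity, or the chosen morphism between [b] and [pi b]
   for [b] outside [A]. *)
Definition entry p : Prop := (exists y, p = cid P (uo y)) \/
  exists f k a, [/\ p = vm (f, k), ~~ A (csrc B f), fob R (csrc B f) = inl a
                  & ctgt B f = sval a].

Definition leave m : Prop := (exists y, m = cid P (uo y)) \/
  exists f k a, [/\ m = vm (f, k), ~~ A (ctgt B f), fob R (ctgt B f) = inl a
                  & csrc B f = sval a].

(** The part of a path after its first factor. Post-composition changes only this part, so closure
    is proved for it first. *)
Definition from_old x : Prop :=
  exists d m, [/\ leave m, tgt (um d) = src m & x = um d ;; m].

Definition through_old x : Prop :=
  exists p d m, [/\ entry p, leave m, tgt p = src (um d), tgt (um d) = src m
                  & x = p ;; um d ;; m].

Lemma from_old_u d : from_old (um d).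
Proof.
exists d, (cid P (uo (ctgt Y d))); split.
- by left; exists (ctgt Y d).
- by rewrite csrc_id tgt_u.
- by rewrite tcomp_idr_at ?tgt_u.
Qed.

Lemma from_old_pre d x :
  from_old x -> tgt (um d) = src x -> from_old (um d ;; x).
Proof.
case=> d' [m [hm' e ->]]; rewrite csrc_tcomp => e'.
have ed : ctgt Y d = csrc Y d' by apply: uo_inj; rewrite -tgt_u e' src_u.
exists (tcomp Y d d'), m; split=> //.
  by rewrite -e !tgt_u ctgt_tcomp.
by rewrite um_comp // tcompA.
Qed.

(** If [f] also ends in [A], it comes from [D]. Otherwise it factors through the coreflection of its
    target, and the counit is the last factor. *)
Lemma from_old_v f k : A (csrc B f) -> from_old (vm (f, k)).
Proof.
move=> ha; case hb: (A (ctgt B f)).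
  have hf : sub_mor A f by rewrite /sub_mor ha hb.
  by rewrite (vm_old k hf); apply: from_old_u.
have [m [g [fe e es et rt]]] := through_counit ha.
exists (Fm (m, k)), (vm (g, k)); rewrite hm tgt_v src_v e; split=> //.
- right; exists g, k, (sub_tgt m); rewrite -et rt hb; split=> //.
- by rewrite [in LHS]fe vm_comp.
Qed.

(** A last factor that is not an identity ends at a new object, which is not the source of anything
    from [D]. *)
Lemma from_old_post_u x d :
  from_old x -> tgt x = src (um d) -> from_old (x ;; um d).
Proof.
case=> d' [m [[[y ->]|[f [k [a [-> nA _ _]]]]] e ->]]; rewrite ctgt_tcomp //.
- rewrite ctgt_id => e'; move: e; rewrite csrc_id => e.
  by rewrite (tcomp_idr_at e); apply: from_old_pre; [exact: from_old_u | rewrite e].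
- by rewrite tgt_v src_u => /(vo_new nA).
Qed.

(** If the last factor is an identity, [f] starts in [A]. Otherwise the last factor [g] composes
    with [f] in [B] to an arrow out of [A]. Either arrow is then normalised afresh. *)
Lemma from_old_post_v x f k :
  from_old x -> tgt x = src (vm (f, k)) -> from_old (x ;; vm (f, k)).
Proof.
case=> d' [m [[[y ->]|[g [l [a [-> nA _ sg]]]]] e ->]]; rewrite ctgt_tcomp //.
- rewrite ctgt_id => e'; move: e; rewrite csrc_id => e.
  rewrite (tcomp_idr_at e); apply: from_old_pre; last by rewrite e.
  by apply: from_old_v; apply: (@vo_old _ k y); rewrite -src_v.
- rewrite tgt_v src_v => e'; have [gf kl] := vo_inj nA e'.
  rewrite -kl in e' *; rewrite tcompA //; last by rewrite tgt_v src_v.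
  rewrite -vm_comp //.
  apply: from_old_pre; last by rewrite src_v csrc_tcomp e src_v.
  by apply: from_old_v; rewrite csrc_tcomp sg (svalP a).
Qed.

Lemma through_oldI p x : entry p -> from_old x -> tgt p = src x ->
  through_old (p ;; x).
Proof.
by move=> hp [d [m [hl e ->]]]; rewrite csrc_tcomp => e'; exists p, d, m.
Qed.

Lemma through_oldE y : through_old y ->
  exists p x, [/\ entry p, from_old x, tgt p = src x & y = p ;; x].
Proof.
case=> p [d [m [hp hl e e' ->]]]; exists p, (um d ;; m); split=> //.
  by exists d, m.
by rewrite csrc_tcomp.
Qed.

Lemma from_through x : from_old x -> through_old x.
Proof.
move=> hx; have [d [m [hl e xe]]] := hx.
have se : uo (csrc Y d) = src x by rewrite xe csrc_tcomp src_u.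
rewrite -(tcomp_idl_at se); apply: through_oldI => //; last by rewrite ctgt_id.
by left; exists (csrc Y d).
Qed.

(** The arrow may enter [A] at any object. Since its source [b] maps into [A], there is an arrow [h]
    from [b] to [pi b], and thinness lets the path enter at [pi b] instead. *)
Lemma through_old_v f g k : A (ctgt B f) -> ctgt B f = csrc B g ->
  through_old (vm (tcomp B f g, k)).
Proof.
move=> ha e; case hb: (A (csrc B f)).
  by apply: from_through; apply: from_old_v; rewrite csrc_tcomp.
have [a [h [ra sh th]]] := to_old ha.
have [h' [sh' th']] := counit ra.
(* This goes from [pi b] back to [b] by the counit and then along [f] and [g]. *)
pose l := tcomp B h' (tcomp B f g).
have -> : tcomp B f g = tcomp B h l.
  apply: thinB; first by rewrite !csrc_tcomp sh.
  by rewrite !ctgt_tcomp // ?csrc_tcomp ?ctgt_tcomp ?csrc_tcomp // ?th ?sh'.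
have hl : ctgt B h = csrc B l by rewrite csrc_tcomp sh' th.
rewrite vm_comp //; apply: through_oldI.
- by right; exists h, k, a; rewrite sh hb.
- by apply: from_old_v; rewrite -hl th (svalP a).
- by rewrite tgt_v src_v hl.
Qed.

Lemma through_old_to f k : A (ctgt B f) -> through_old (vm (f, k)).
Proof.
move=> ha; rewrite -[f](tcomp_idr B); apply: through_old_v => //.
by rewrite csrc_id.
Qed.

Lemma through_old_post_u x d :
  through_old x -> tgt x = src (um d) -> through_old (x ;; um d).
Proof.
move=> /through_oldE [p [y [hp hy e ->]]]; rewrite ctgt_tcomp // => e'.
rewrite tcompA //; apply: through_oldI; rewrite ?csrc_tcomp //.
exact: from_old_post_u.
Qed.

Lemma through_old_post_v x f k :
  through_old x -> tgt x = src (vm (f, k)) -> through_old (x ;; vm (f, k)).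
Proof.
move=> /through_oldE [p [y [hp hy e ->]]]; rewrite ctgt_tcomp // => e'.
rewrite tcompA //; apply: through_oldI; rewrite ?csrc_tcomp //.
exact: from_old_post_v.
Qed.

Definition normal x : Prop := (exists f k, x = vm (f, k)) \/ through_old x.

Lemma normal_post_u x d : normal x -> tgt x = src (um d) -> normal (x ;; um d).
Proof.
case=> [[f [k ->]]|hx] e; right; apply: through_old_post_u => //.
by apply: through_old_to; apply: (@vo_old _ k (csrc Y d)); rewrite -tgt_v e src_u.
Qed.

(** If [x] comes from [B] and ends over [A], it is already a path through [D]. Otherwise it ends at
    a new object, which determines both coordinates, so it composes with [f] inside [B]. *)
Lemma normal_post_v x f k :
  normal x -> tgt x = src (vm (f, k)) -> normal (x ;; vm (f, k)).
Proof.
case=> [[g [l ->]]|hx] e; last by right; apply: through_old_post_v.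
case ha: (A (ctgt B g)).
  by right; apply: through_old_post_v => //; apply: through_old_to.
move: (e); rewrite tgt_v src_v => e'.
have [gf kl] := vo_inj (negbT ha) e'.
by left; exists (tcomp B g f), k; rewrite kl vm_comp.
Qed.

(** Induction on the generation of [y], with [x] arbitrary: for a composite, its first factor is
    absorbed before its second. *)
Lemma normal_post x y : normal x -> Gen y -> tgt x = src y -> normal (x ;; y).
Proof.
move=> hx hy; elim: hy x hx => [d|f k|f g _ ihf _ ihg e] x hx.
- exact: normal_post_u.
- exact: normal_post_v.
- rewrite csrc_tcomp => e'; rewrite -tcompA //; apply: (ihg _ (ihf _ hx e')).
  by rewrite ctgt_tcomp.
Qed.

Lemma Gen_normal x : Gen x -> normal x.
Proof.
elim=> [d|f k|f g hf nf hg _ e].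
  by right; apply: from_through; apply: from_old_u.
  by left; exists f, k.
exact: normal_post.
Qed.
End GeneratedMorphisms.

(** * Double subcategories of a pushout *)

Section StructureAlongInjection.
Variables (O M O' M' : Type) (X : cat_on O M) (io : O' -> O) (im : M' -> M).
Variables (s t : M' -> O') (i : O' -> M') (c : forall f g, t f = s g -> M').
Hypotheses (io_inj : injective io) (im_inj : injective im).
Hypothesis hs : forall f, io (s f) = csrc X (im f).
Hypothesis ht : forall f, io (t f) = ctgt X (im f).
Hypothesis hi : forall x, im (i x) = cid X (io x).
Hypothesis hc : forall f g e, im (@c f g e) = tcomp X (im f) (im g).

Lemma composable_along f g : t f = s g -> ctgt X (im f) = csrc X (im g).
Proof. by rewrite -ht -hs => ->. Qed.

(** Injectivity pulls each law back from [X], so that only the operations and their compatibility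
    with [X] have to be supplied. *)
Definition cat_of_inj : cat_on O' M'.
Proof.
refine (@CatOn _ _ s t i c _ _ _ _ _ _ _).
- by move=> x; apply: io_inj; rewrite hs hi csrc_id.
- by move=> x; apply: io_inj; rewrite ht hi ctgt_id.
- by move=> f g e; apply: io_inj; rewrite !hs hc csrc_tcomp.
- move=> f g e; apply: io_inj; rewrite !ht hc ctgt_tcomp //.
  exact: composable_along.
- by move=> f e; apply: im_inj; rewrite hc hi hs tcomp_idl.
- by move=> f e; apply: im_inj; rewrite hc hi ht tcomp_idr.
- move=> f g h e1 e2 e3 e4; apply: im_inj.
  by rewrite !hc tcompA //; apply: composable_along.
Defined.
End StructureAlongInjection.

Lemma sval_inj (T : Type) (Q : T -> Prop) : injective (@sval T Q).
Proof. by case=> x hx [y hy] /= e; apply: eq_exist. Qed.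

Section SubDoubleCategory.
Variables (P : dblcat) (Qv : vmor P -> Prop) (Qs : sq P -> Prop).
Hypothesis Qv_id : forall x, Qv (cid (vcat P) x).
Hypothesis Qs_vid : forall h, Qs (cid (vsq P) h).
Hypothesis Qs_hid : forall f, Qv f -> Qs (cid (hsq P) f).
Hypothesis Qv_comp : forall f g, Qv f -> Qv g ->
  ctgt (vcat P) f = csrc (vcat P) g -> Qv (tcomp (vcat P) f g).
Hypothesis Qs_vcomp : forall f g, Qs f -> Qs g ->
  ctgt (vsq P) f = csrc (vsq P) g -> Qs (tcomp (vsq P) f g).
Hypothesis Qs_hcomp : forall f g, Qs f -> Qs g ->
  ctgt (hsq P) f = csrc (hsq P) g -> Qs (tcomp (hsq P) f g).
Hypothesis Q_left : forall a, Qs a -> Qv (csrc (hsq P) a).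
Hypothesis Q_right : forall a, Qs a -> Qv (ctgt (hsq P) a).

Definition sub_vcat : cat_on (dob P) {f | Qv f}.
Proof.
refine (@cat_of_inj _ _ _ _ (vcat P) id sval (fun f => csrc (vcat P) (sval f))
  (fun f => ctgt (vcat P) (sval f)) (fun x => exist _ _ (Qv_id x))
  (fun f g e => exist _ _ (Qv_comp (svalP f) (svalP g) e)) _ _ _ _ _ _) => //.
exact: sval_inj.
Defined.

Definition sub_vsq : cat_on (hmor P) {a | Qs a}.
Proof.
refine (@cat_of_inj _ _ _ _ (vsq P) id sval (fun f => csrc (vsq P) (sval f))
  (fun f => ctgt (vsq P) (sval f)) (fun x => exist _ _ (Qs_vid x))
  (fun f g e => exist _ _ (Qs_vcomp (svalP f) (svalP g) e)) _ _ _ _ _ _) => //.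
exact: sval_inj.
Defined.

Definition sub_hsq : cat_on {f | Qv f} {a | Qs a}.
Proof.
refine (@cat_of_inj _ _ _ _ (hsq P) sval sval
  (fun f => exist _ _ (Q_left (svalP f))) (fun f => exist _ _ (Q_right (svalP f)))
  (fun x => exist _ _ (Qs_hid (svalP x)))
  (fun f g e => exist _ _ (Qs_hcomp (svalP f) (svalP g) (congr1 sval e)))
  _ _ _ _ _ _) => //; exact: sval_inj.
Defined.

(** Only vertical morphisms and squares are cut down; the horizontal category is that of [P]. *)
Definition sub_dblcat : dblcat.
Proof.
refine (@DblCat _ _ _ _ (hcat P) sub_vcat sub_hsq sub_vsq _ _ _ _ _ _ _).
- split=> /=.
  + by move=> f; apply: src_left.
  + by move=> f; apply: tgt_left.
  + by move=> x; apply: sval_inj; rewrite /= (fun_id (left_functor P)).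
  + by move=> f g e e'; apply: sval_inj; rewrite /= (fun_tcomp (left_functor P)).
- split=> /=.
  + by move=> f; rewrite src_right.
  + by move=> f; rewrite tgt_right.
  + by move=> x; apply: sval_inj; rewrite /= (fun_id (right_functor P)).
  + by move=> f g e e'; apply: sval_inj; rewrite /= (fun_tcomp (right_functor P)).
- split=> /=.
  + by move=> f; rewrite (fun_src (hid_functor P)).
  + by move=> f; rewrite (fun_tgt (hid_functor P)).
  + by move=> x; apply: sval_inj; rewrite /= (fun_id (hid_functor P)).
  + by move=> f g e e'; apply: sval_inj; rewrite /= (fun_tcomp (hid_functor P)).
- by move=> a b e e'; rewrite /= tcompE top_tcomp //; apply: (congr1 sval e).
- by move=> a b e e'; rewrite /= tcompE bot_tcomp //; apply: (congr1 sval e).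
- by move=> h k e e'; apply: sval_inj; rewrite /= tcompE vid_tcomp.
- move=> a b c d eab ecd eac ebd e1 e2; apply: sval_inj => /=.
  by apply: tinterchange => //;
    [exact: (congr1 sval eab) | exact: (congr1 sval ecd)].
Defined.

Definition sub_dbl_incl : dblfunctor sub_dblcat P.
Proof.
refine (@DblFunctor sub_dblcat P id id sval sval _ _ _ _).
- exact: is_functor_id.
- by split=> //= f g e e'; rewrite tcompE.
- by split=> //= f g e e'; rewrite tcompE.
- by split=> //= f g e e'; rewrite tcompE.
Defined.

Section Corestriction.
Variables (E : dblcat) (G : dblfunctor E P).
Hypothesis hGv : forall f, Qv (dfv G f).
Hypothesis hGs : forall a, Qs (dfsq G a).

Definition sub_dbl_lift : dblfunctor E sub_dblcat.
Proof.
refine (@DblFunctor E sub_dblcat (dfob G) (dfh G) (fun f => exist _ _ (hGv f))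
  (fun a => exist _ _ (hGs a)) (df_hcat G) _ _ _).
- have h := df_vcat G; split=> /= [f|f|x|f g e e'].
  + exact: (fun_src h).
  + exact: (fun_tgt h).
  + by apply: sval_inj; rewrite /= (fun_id h).
  + by apply: sval_inj; rewrite /= tcompE (fun_tcomp h).
- have h := df_hsq G; split=> /= [f|f|x|f g e e'].
  + by apply: sval_inj; apply: (fun_src h).
  + by apply: sval_inj; apply: (fun_tgt h).
  + by apply: sval_inj; rewrite /= (fun_id h).
  + by apply: sval_inj; rewrite /= tcompE (fun_tcomp h).
- have h := df_vsq G; split=> /= [f|f|x|f g e e'].
  + exact: (fun_src h).
  + exact: (fun_tgt h).
  + by apply: sval_inj; rewrite /= (fun_id h).
  + by apply: sval_inj; rewrite /= tcompE (fun_tcomp h).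
Defined.
End Corestriction.

(** Both [u] and [v] corestrict to the double subcategory. The induced double functor from [P],
    followed by the inclusion, agrees with the identity after [u] and [v], so it is the identity and
    every cell satisfies its predicate. *)
Lemma pushout_generated (S D E : dblcat) (F : dblfunctor S D)
    (G : dblfunctor S E) (u : dblfunctor D P) (v : dblfunctor E P) :
  is_pushout F G u v ->
  (forall f, Qv (dfv u f)) -> (forall a, Qs (dfsq u a)) ->
  (forall f, Qv (dfv v f)) -> (forall a, Qs (dfsq v a)) ->
  (forall f, Qv f) /\ (forall a, Qs a).
Proof.
move=> hP uv us vv vs; have [ho hh hv hs] := hP.1.
have := hP.2 _ (sub_dbl_lift uv us) (sub_dbl_lift vv vs).
case.
  split=> x; [exact: ho | exact: hh | |]; apply: sval_inj;
    [exact: hv | exact: hs].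
move=> w [[[uo uh u1 u2] [o h v1 v2]] _].
pose w' := dblfunctor_comp w sub_dbl_incl.
pose i := DblFunctor (is_functor_id (hcat P)) (is_functor_id (vcat P))
  (is_functor_id (hsq P)) (is_functor_id (vsq P)).
have [||_ _ ev es] := @pushout_unique _ _ _ _ _ _ _ _ hP P w' i.
- split=> x /=; [exact: uo | exact: uh | |].
    exact: (congr1 sval (u1 x)).
  exact: (congr1 sval (u2 x)).
- split=> x /=; [exact: o | exact: h | |].
    exact: (congr1 sval (v1 x)).
  exact: (congr1 sval (v2 x)).
split=> x; first by rewrite -[x]ev; apply: svalP.
by rewrite -[x]es; apply: svalP.
Qed.
End SubDoubleCategory.

(** * Horizontal composites of squares *)

Section HorizontalClosure.
Variables (B : category) (A : pred (Ob B)).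
Hypothesis thinB : thin B.
Variable R : functor B (cone (full_sub A)).
Hypothesis R_old : forall a, fob R (sval a) = inl a.
Hypothesis counit : forall b a, fob R b = inl a ->
  exists f, csrc B f = sval a /\ ctgt B f = b.
Hypothesis to_old : forall f, A (ctgt B f) -> exists a g,
  [/\ fob R (csrc B f) = inl a, csrc B g = csrc B f & ctgt B g = sval a].

Variables (C : category) (D P : dblcat).
Variables (F : dblfunctor (extprod (full_sub A) C) D).
Variables (u : dblfunctor D P) (v : dblfunctor (extprod B C) P).
Hypothesis hP :
  is_pushout F (extprod_functor (full_incl A) (functor_id C)) u v.

(** Together with [cone_mor], this applies [R] and then [F], and is the leg from [extprod B C] of a
    cocone over [vcat D] with a new initial object. *)
Definition cone_ob (x : Ob B * Ob C) : dob D + unit :=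
  match fob R x.1 with
  | inl a => inl (dfob F (a, x.2))
  | inr _ => inr tt
  end.

Definition cone_mor (x : Mor B * Ob C) : (vmor D + dob D) + unit :=
  match fmor R x.1 with
  | inl (inl m) => inl (inl (dfv F (m, x.2)))
  | inl (inr a) => inl (inr (dfob F (a, x.2)))
  | inr _ => inr tt
  end.

Lemma is_functor_cone_mor :
  is_functor (vcat (extprod B C)) (cone_on (vcat D)) cone_ob cone_mor.
Proof.
have [hR hF] := (functorP R, df_vcat F).
apply: is_functor_tcomp => /=.
- case=> f c; rewrite /cone_ob /cone_mor /= -(fun_src hR).
  by case: (fmor R f) => [[m|a]|[]] //=; rewrite (fun_src hF).
- case=> f c; rewrite /cone_ob /cone_mor /= -(fun_tgt hR).
  by case: (fmor R f) => [[m|a]|[]] //=; rewrite (fun_tgt hF).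
- case=> b c; rewrite /cone_ob /cone_mor /= (fun_id hR).
  by case: (fob R b) => [a|[]] //=; rewrite -(fun_id hF).
- case=> f c [g c']; rewrite /pair_tgt /pair_src /= => -[e <-].
  rewrite prod_tcomp //= disc_tcomp /cone_mor /= (fun_tcomp hR) //.
  have : ctgt (cone (full_sub A)) (fmor R f) = csrc (cone (full_sub A)) (fmor R g).
    by rewrite (fun_tgt hR) (fun_src hR) e.
  move=> eR; rewrite [in LHS]cone_tcomp //; move: eR.
  case: (fmor R f) => [[m|a]|[]]; case: (fmor R g) => [[n|a']|[]] //= e'.
  + have {}e' := inl_injective e'.
    have e2 : ctgt (vcat D) (dfv F (m, c)) = csrc (vcat D) (dfv F (n, c)).
      by rewrite (fun_tgt hF) (fun_src hF); congr (dfob F (_, _)).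
    rewrite cone_tcomp /= ?e2 //.
    rewrite -(fun_tcomp hF) /=; last by congr (_, _).
    by rewrite prod_tcomp //= disc_tcomp.
  + have {}e' := inl_injective e'.
    rewrite cone_tcomp /=; first by rewrite (fun_tgt hF).
    by rewrite e' (fun_src hF).
  + by rewrite cone_tcomp.
  + by rewrite cone_tcomp.
Qed.

(** The two legs agree over [A] because there [R] is the identity, by thinness. If both ends of [f]
    have coreflection [a], then [R] sends [f] to an endomorphism of [a], which is an identity for
    the same reason. *)
Lemma detect_middle : exists w : functor (vcategory P) (cone (vcategory D)),
  (forall d, fmor w (dfv u d) = inl (inl d)) /\
  forall f a c, fob R (csrc B f) = inl a -> fob R (ctgt B f) = inl a ->
    is_identity (cone (vcategory D)) (fmor w (dfv v (f, c))).
Proof.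
pose s := @Functor (vcategory D) (cone (vcategory D)) _ _
  (is_functor_cone_inl (vcat D)).
pose t := @Functor (vcategory (extprod B C)) (cone (vcategory D)) _ _
  is_functor_cone_mor.
have Rs := fun_src (functorP R); have Rt := fun_tgt (functorP R).
have [|w [[_ wu] [_ wv]]] := @pushout_vfunctor _ _ _ _ _ _ _ _ hP _ s t.
  split=> [[a c]|[f c]]; rewrite /= /cone_ob /cone_mor /=.
    by rewrite R_old.
  case/andP: (svalP f) => sf tf.
  have [] := (Rs (sval f), Rt (sval f)).
  have := R_old (sub_src f); rewrite /= => -> /=.
  have := R_old (sub_tgt f); rewrite /= => -> /=.
  case: (fmor R (sval f)) => [[m|x]|x] //= [es] [et].
  by rewrite (_ : m = f) //; apply: (thin_sub thinB); apply: val_inj.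
exists w; split=> [d|f a c rs rt]; first exact: wu.
exists (inl (dfob F (a, c))).
have -> : fmor w (dfv v (f, c)) = cone_mor (f, c) := wv (f, c).
rewrite /cone_mor /=; move: (Rs f) (Rt f); rewrite rs rt /=.
case: (fmor R f) => [[m|x]|x] //= [es] [et].
rewrite -(fun_id (df_vcat F)) /= (_ : m = cid (full_sub A) a) //.
by apply: (thin_sub thinB); rewrite ?csrc_id ?ctgt_id ?es ?et.
Qed.

Let inj_ob : injective (canonical_ob A u v).
Proof. exact: bij_inj (pushout_objects hP). Qed.
Let inj_h := pushout_hmor_inj hP.

Let ho a k : dfob u (dfob F (a, k)) = dfob v (sval a, k).
Proof. by have [h _ _ _] := hP.1; apply: h (a, k). Qed.
Let hh a k : dfh u (dfh F (a, k)) = dfh v (sval a, k).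
Proof. by have [_ h _ _] := hP.1; apply: h (a, k). Qed.
Let hv a k : dfv u (dfv F (a, k)) = dfv v (sval a, k).
Proof. by have [_ _ h _] := hP.1; apply: h (a, k). Qed.
Let hs a k : dfsq u (dfsq F (a, k)) = dfsq v (sval a, k).
Proof. by have [_ _ _ h] := hP.1; apply: h (a, k). Qed.

Definition ventry := entry R (vcat P) (dfob u) (dfv v).
Definition vleave := leave R (vcat P) (dfob u) (dfv v).
Definition sentry := entry R (vsq P) (dfh u) (dfsq v).
Definition sleave := leave R (vsq P) (dfh u) (dfsq v).
Definition sthrough := through_old R (vsq P) (dfh u) (dfsq u) (dfsq v).
Definition vgen := Gen (vcat P) (dfv u) (dfv v).
Definition sgen := Gen (vsq P) (dfsq u) (dfsq v).

(* The functor [w] sends [p] and [m] to identities. *)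
Lemma middle_inj p d d' m : ventry p -> vleave m ->
  ctgt (vcat P) p = csrc (vcat P) (dfv u d) ->
  ctgt (vcat P) (dfv u d) = csrc (vcat P) m ->
  ctgt (vcat P) p = csrc (vcat P) (dfv u d') ->
  ctgt (vcat P) (dfv u d') = csrc (vcat P) m ->
  tcomp (vcat P) p (tcomp (vcat P) (dfv u d) m) =
  tcomp (vcat P) p (tcomp (vcat P) (dfv u d') m) -> d = d'.
Proof.
have [w [wu wv]] := detect_middle; have hw := functorP w.
move=> hp hm e1 e2 e1' e2' /(congr1 (fmor w)).
have wid x : is_identity (cone (vcategory D)) (fmor w (cid (vcat P) x)).
  by exists (fob w x); rewrite -(fun_id hw).
have [x wp] : is_identity (cone (vcategory D)) (fmor w p).
  case: hp => [[y ->]|[f [k [a [-> _ ra ta]]]]]; first exact: wid.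
  by apply: (wv f a) => //; rewrite ta R_old.
have [y wm] : is_identity (cone (vcategory D)) (fmor w m).
  case: hm => [[z ->]|[f [k [a [-> _ ra ta]]]]]; first exact: wid.
  by apply: (wv f a) => //; rewrite ta R_old.
have simp d0 : ctgt (vcat P) p = csrc (vcat P) (dfv u d0) ->
    ctgt (vcat P) (dfv u d0) = csrc (vcat P) m ->
    fmor w (tcomp (vcat P) p (tcomp (vcat P) (dfv u d0) m)) = inl (inl d0).
  move=> e e'; rewrite !(fun_tcomp hw) ?csrc_tcomp // wu wp wm.
  have ew : ctgt (cone (vcategory D)) (inl (inl d0)) = y.
    by rewrite -wu (fun_tgt hw) /= e' -(fun_src hw) wm csrc_id.
  have ex : x = csrc (cone (vcategory D)) (inl (inl d0)).
    by rewrite -wu (fun_src hw) /= -e -(fun_tgt hw) wp ctgt_id.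
  by rewrite tcomp_idr_at // tcomp_idl_at.
by rewrite !simp // => -[].
Qed.

(** An entry square is determined by its top: over a new [b] its vertical part is the only arrow
    from [b] to [pi b]. The mixed cases cannot occur, since the common corner would be both new and
    in [D]. *)
Lemma sentry_hcomp p p' : sentry p -> sentry p' ->
  ctgt (hcat P) (csrc (vsq P) p) = csrc (hcat P) (csrc (vsq P) p') ->
  [/\ ctgt (hsq P) p = csrc (hsq P) p', ventry (ctgt (hsq P) p)
    & sentry (tcomp (hsq P) p p')].
Proof.
have hR := right_functor P; have hL := left_functor P.
have [hu hv'] := (df_hcat u, df_hcat v).
have [hus hvs] := (df_hsq u, df_hsq v).
case=> [[h ->]|[f [g [a [-> nf rf tf]]]]];
    case=> [[h' ->]|[f' [g' [a' [-> nf' rf' tf']]]]].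
- rewrite !csrc_id (fun_id hR) (fun_id hL) (fun_tgt hu) (fun_src hu) => e.
  split; first by rewrite e.
    by left; exists (ctgt (hcat D) h).
  left; exists (tcomp (hcat D) h h').
  have e' : ctgt (hcat D) h = csrc (hcat D) h' := uo_inj inj_ob e.
  by rewrite (fun_tcomp hu) // vid_tcomp // (fun_tgt hu) (fun_src hu).
- rewrite csrc_id (fun_src (df_vsq v)) /= /pair_src /= (fun_tgt hu) (fun_src hv') /=.
  by rewrite /pair_src /= => /esym /(vo_new inj_ob nf').
- rewrite csrc_id (fun_src (df_vsq v)) /= /pair_src /= (fun_src hu) (fun_tgt hv') /=.
  by rewrite /pair_tgt /= => /(vo_new inj_ob nf).
- rewrite !(fun_src (df_vsq v)) /= (fun_src hv') (fun_tgt hv') /=.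
  rewrite /pair_src /pair_tgt /= => e.
  have [sf eg] := vo_inj ho inj_ob nf e.
  have ea : a = a' by move: rf; rewrite sf rf' => -[].
  have ef : f = f' by apply: thinB; rewrite // tf tf' ea.
  rewrite (fun_tgt hvs) (fun_src hvs) /= /pair_src /pair_tgt /= -ef -eg.
  split=> //; first by right; exists f, (ctgt C g), a.
  right; exists f, (tcomp C g g'), a; split=> //.
  rewrite -(fun_tcomp hvs) /=; last by rewrite /pair_src /pair_tgt /= eg.
  by rewrite prod_tcomp //= disc_tcomp.
Qed.

(** As for entry squares, with bottoms in place of tops and the counit in place of the arrow to
    [pi b]. *)
Lemma sleave_hcomp p p' : sleave p -> sleave p' ->
  ctgt (hcat P) (ctgt (vsq P) p) = csrc (hcat P) (ctgt (vsq P) p') ->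
  [/\ ctgt (hsq P) p = csrc (hsq P) p', vleave (ctgt (hsq P) p)
    & sleave (tcomp (hsq P) p p')].
Proof.
have hR := right_functor P; have hL := left_functor P.
have [hu hv'] := (df_hcat u, df_hcat v).
have [hus hvs] := (df_hsq u, df_hsq v).
case=> [[h ->]|[f [g [a [-> nf rf tf]]]]];
    case=> [[h' ->]|[f' [g' [a' [-> nf' rf' tf']]]]].
- rewrite !ctgt_id (fun_id hR) (fun_id hL) (fun_tgt hu) (fun_src hu) => e.
  split; first by rewrite e.
    by left; exists (ctgt (hcat D) h).
  left; exists (tcomp (hcat D) h h').
  have e' : ctgt (hcat D) h = csrc (hcat D) h' := uo_inj inj_ob e.
  by rewrite (fun_tcomp hu) // vid_tcomp // (fun_tgt hu) (fun_src hu).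
- rewrite ctgt_id (fun_tgt (df_vsq v)) /= /pair_tgt /= (fun_tgt hu) (fun_src hv') /=.
  by rewrite /pair_src /= => /esym /(vo_new inj_ob nf').
- rewrite ctgt_id (fun_tgt (df_vsq v)) /= /pair_tgt /= (fun_src hu) (fun_tgt hv') /=.
  by rewrite /pair_tgt /= => /(vo_new inj_ob nf).
- rewrite !(fun_tgt (df_vsq v)) /= (fun_src hv') (fun_tgt hv') /=.
  rewrite /pair_src /pair_tgt /= => e.
  have [sf eg] := vo_inj ho inj_ob nf e.
  have ea : a = a' by move: rf; rewrite sf rf' => -[].
  have ef : f = f' by apply: thinB; rewrite // tf tf' ea.
  rewrite (fun_tgt hvs) (fun_src hvs) /= /pair_src /pair_tgt /= -ef -eg.
  split=> //; first by right; exists f, (ctgt C g), a.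
  right; exists f, (tcomp C g g'), a; split=> //.
  rewrite -(fun_tcomp hvs) /=; last by rewrite /pair_src /pair_tgt /= eg.
  by rewrite prod_tcomp //= disc_tcomp.
Qed.

(** First factors match along their tops and last factors along their bottoms. Once the middle
    squares are composable in [D], interchange composes the three layers separately. *)
Lemma sthrough_hcomp x y : sthrough x -> sthrough y ->
  ctgt (hsq P) x = csrc (hsq P) y -> sthrough (tcomp (hsq P) x y).
Proof.
have hR := right_functor P; have hL := left_functor P.
have hus := df_hsq u.
case=> [p [d [m [hp hm e1 e2 ->]]]] [p' [d' [m' [hp' hm' e1' e2' ->]]]] e.
have := tops_composable e; have := bots_composable e.
rewrite !csrc_tcomp !ctgt_tcomp ?csrc_tcomp // => eb et.
have [ep vp sp] := sentry_hcomp hp hp' et.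
have [em vm sm] := sleave_hcomp hm hm' eb.
have r1 : ctgt (vcat P) (ctgt (hsq P) p) = csrc (vcat P) (dfv u (ctgt (hsq D) d)).
  by rewrite -(fun_tgt hus) tgt_right src_right e1.
have r2 : ctgt (vcat P) (dfv u (ctgt (hsq D) d)) = csrc (vcat P) (ctgt (hsq P) m).
  by rewrite -(fun_tgt hus) tgt_right src_right e2.
have r1' : ctgt (vcat P) (ctgt (hsq P) p) = csrc (vcat P) (dfv u (csrc (hsq D) d')).
  by rewrite -(fun_src hus) ep tgt_left src_left e1'.
have r2' : ctgt (vcat P) (dfv u (csrc (hsq D) d')) = csrc (vcat P) (ctgt (hsq P) m).
  by rewrite -(fun_src hus) em tgt_left src_left e2'.
(* The common side of [x] and [y] is factored twice, with the same outer factors, so the middle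
   factors coincide. *)
have ed : ctgt (hsq D) d = csrc (hsq D) d'.
  apply: (middle_inj vp vm) => //.
  rewrite -(fun_tgt hus) -(fun_src hus) -!(fun_tcomp hR) ?csrc_tcomp // e.
  by rewrite ep em -!(fun_tcomp hL) ?csrc_tcomp.
have eud : ctgt (hsq P) (dfsq u d) = csrc (hsq P) (dfsq u d').
  by rewrite (fun_tgt hus) (fun_src hus) ed.
exists (tcomp (hsq P) p p'), (tcomp (hsq D) d d'), (tcomp (hsq P) m m').
rewrite (fun_tcomp hus) //; split=> //.
- by rewrite bot_tcomp // top_tcomp // e1 e1'.
- by rewrite bot_tcomp // top_tcomp // e2 e2'.
- rewrite !tinterchange ?csrc_tcomp //.
  by rewrite (fun_tcomp hR) // (fun_tcomp hL) // eud em.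
Qed.

(** If the source [b] of [f] is new, a shared top corner forces [p] to lie over an arrow [f'] from
    [b] to [pi b]. Then [f] is [f'], followed by the counit and [f] itself, hence passes through
    [A]. *)
Lemma entry_through p f c g : sentry p ->
  dfob v (csrc B f, c) = csrc (hcat P) (csrc (vsq P) p) \/
  dfob v (csrc B f, c) = ctgt (hcat P) (csrc (vsq P) p) ->
  sthrough (dfsq v (f, g)).
Proof.
move=> hp hc; case ha: (A (csrc B f)).
  apply: (from_through (df_vsq u)).
  by apply: (from_old_v thinB R_old counit (df_vsq u) (df_vsq v) hs).
case: hp hc => [[h ->]|[f' [g' [a [-> nf rf tf]]]]].
  rewrite csrc_id (fun_src (df_hcat u)) (fun_tgt (df_hcat u)).
  by case=> /(vo_new inj_ob (negbT ha)).
rewrite (fun_src (df_vsq v)) /= (fun_src (df_hcat v)) (fun_tgt (df_hcat v)) /=.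
rewrite /pair_src /pair_tgt /= => hc.
have {}hc : csrc B f = csrc B f' by case: hc => /(vo_inj ho inj_ob (negbT ha)) [].
have [h [sh th]] := counit rf.
have e1 : ctgt B h = csrc B f by rewrite th.
have e2 : ctgt B f' = csrc B (tcomp B h f) by rewrite csrc_tcomp tf sh.
have -> : f = tcomp B f' (tcomp B h f).
  by apply: thinB; rewrite ?csrc_tcomp // !ctgt_tcomp.
apply: (through_old_v thinB R_old counit to_old (df_vsq u) (df_vsq v) hs) => //.
by rewrite tf (svalP a).
Qed.

Lemma sgen_through x : sthrough x -> sgen x.
Proof.
have gid h : sgen (cid (vsq P) (dfh u h)).
  by rewrite -(fun_id (df_vsq u)); apply: Gen_u.
case=> p [d [m [hp hm e1 e2 ->]]].
have gp : sgen p by case: hp => [[h ->]|[f [g [a [-> _ _ _]]]]] //; apply: Gen_v.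
have gm : sgen m by case: hm => [[h ->]|[f [g [a [-> _ _ _]]]]] //; apply: Gen_v.
apply: Gen_comp => //; last by rewrite csrc_tcomp.
by apply: Gen_comp => //; apply: Gen_u.
Qed.

Lemma sgen_normal x : sgen x -> normal R (vsq P) (dfh u) (dfsq u) (dfsq v) x.
Proof.
exact: (Gen_normal thinB R_old counit to_old (df_vsq u) (df_vsq v) hh hs inj_h).
Qed.

Lemma vgen_normal x : vgen x -> normal R (vcat P) (dfob u) (dfv u) (dfv v) x.
Proof.
exact: (Gen_normal thinB R_old counit to_old (df_vcat u) (df_vcat v) ho hv inj_ob).
Qed.

(** If one square passes through [D], so does its neighbour, by their common top corner. If neither
    does, both come from [extprod B C] with vertical parts between the same new objects; thinness
    makes these parts equal and the squares compose there. *)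
Lemma sgen_hcomp x y : sgen x -> sgen y ->
  ctgt (hsq P) x = csrc (hsq P) y -> sgen (tcomp (hsq P) x y).
Proof.
move=> /sgen_normal nx /sgen_normal ny e.
have [hx|hx] := pselect (sthrough x); have [hy|hy] := pselect (sthrough y).
- by apply: sgen_through; apply: sthrough_hcomp.
- case: ny => [[f [g ey]]|//]; case: hy; rewrite ey.
  case: hx => p [d [m [hp hm e1 e2 ex]]].
  apply: (@entry_through p f (csrc C g)) => //; right.
  have := tops_composable e; rewrite ex ey !csrc_tcomp => ->.
  by rewrite (fun_src (df_vsq v)) /= (fun_src (df_hcat v)).
- case: nx => [[f [g ex]]|//]; case: hx; rewrite ex.
  case: hy => p [d [m [hp hm e1 e2 ey]]].
  apply: (@entry_through p f (ctgt C g)) => //; left.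
  have := tops_composable e; rewrite ex ey !csrc_tcomp => <-.
  by rewrite (fun_src (df_vsq v)) /= (fun_tgt (df_hcat v)).
- case: nx hx e => [[f [g ->]] hx|//]; case: ny hy => [[f' [g' ->]] hy|//] e.
  have sf : ~~ A (csrc B f).
    apply/negP => ha; apply: hx; apply: (from_through (df_vsq u)).
    by apply: (from_old_v thinB R_old counit (df_vsq u) (df_vsq v) hs).
  have tf : ~~ A (ctgt B f).
    apply/negP => ha; apply: hx.
    by apply: (through_old_to thinB R_old counit to_old (df_vsq u) (df_vsq v) hs).
  have := tops_composable e; have := bots_composable e.
  rewrite !(fun_src (df_vsq v)) !(fun_tgt (df_vsq v)) /=.
  rewrite !(fun_src (df_hcat v)) !(fun_tgt (df_hcat v)) /= /pair_src /pair_tgt /=.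
  move=> /(vo_inj ho inj_ob tf) [et eg] /(vo_inj ho inj_ob sf) [es _].
  have ef : f = f' by apply: thinB.
  rewrite -ef -(fun_tcomp (df_hsq v)) /=; last by rewrite /pair_src /pair_tgt /= eg.
  by rewrite prod_tcomp //= disc_tcomp; apply: Gen_v.
Qed.

Lemma vgen_side (fo : hmor P -> dob P) (fm : sq P -> vmor P) :
  is_functor (vsq P) (vcat P) fo fm ->
  (forall d, exists e, fm (dfsq u d) = dfv u e) ->
  (forall q, exists e, fm (dfsq v q) = dfv v e) ->
  forall x, sgen x -> vgen (fm x).
Proof.
move=> h hu hv' x; elim=> [d|f k|f g _ gf _ gg e].
- by have [d' ->] := hu d; apply: Gen_u.
- by have [[f' k'] ->] := hv' (f, k); apply: Gen_v.
- by rewrite (fun_tcomp h) //; apply: Gen_comp; rewrite ?(fun_tgt h) ?(fun_src h) ?e.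
Qed.

(** The generated cells form a double subcategory containing the images of [u] and [v]. Identities
    are generated because every object and every horizontal morphism of [P] comes from [D] or from
    [extprod B C]. *)
Lemma all_generated : (forall x, vgen x) /\ (forall x, sgen x).
Proof.
apply: (@pushout_generated P vgen sgen _ _ _ _ _ _ _ _ _ _ _ _ _ u v hP).
- move=> x; have [g _ hg] := pushout_objects hP; rewrite -[x]hg.
  case: (g x) => [d|[b c]] /=.
    by rewrite -(fun_id (df_vcat u)); apply: Gen_u.
  by rewrite -(fun_id (df_vcat v)); apply: Gen_v.
- move=> x; have [G [_ [_ hg]]] := pushout_hcategory hP.
  have := hg x => /= <-; case: (fmor G x) => [d|[b c]] /=.
    by rewrite -(fun_id (df_vsq u)); apply: Gen_u.
  by rewrite -(fun_id (df_vsq v)); apply: Gen_v.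
- move=> x; elim=> [d|f k|f g hf gf hg gg e].
  + by rewrite -(fun_id (df_hsq u)); apply: Gen_u.
  + by rewrite -(fun_id (df_hsq v)); apply: Gen_v.
  + rewrite (fun_tcomp (hid_functor P)) //; apply: Gen_comp => //.
    by rewrite (fun_tgt (hid_functor P)) (fun_src (hid_functor P)) e.
- by move=> f g hf hg e; apply: Gen_comp.
- by move=> f g hf hg e; apply: Gen_comp.
- exact: sgen_hcomp.
- apply: (vgen_side (left_functor P)) => a.
    by exists (csrc (hsq D) a); rewrite (fun_src (df_hsq u)).
  by exists (csrc (hsq (extprod B C)) a); rewrite (fun_src (df_hsq v)).
- apply: (vgen_side (right_functor P)) => a.
    by exists (ctgt (hsq D) a); rewrite (fun_tgt (df_hsq u)).
  by exists (ctgt (hsq (extprod B C)) a); rewrite (fun_tgt (df_hsq v)).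
- by move=> d; apply: Gen_u.
- by move=> d; apply: Gen_u.
- by case=> f k; apply: Gen_v.
- by case=> f k; apply: Gen_v.
Qed.
End HorizontalClosure.

(** * The two inclusions *)

Lemma comp3I (O M : Type) (X : cat_on O M) (f g h : M) :
  ctgt X f = csrc X g -> ctgt X g = csrc X h ->
  is_comp3 X f g h (tcomp X f (tcomp X g h)).
Proof.
move=> e e'; have e2 : ctgt X (ccomp X e) = csrc X h by rewrite ctgt_comp.
by exists e, e2; rewrite -tcompA // !tcompE.
Qed.

Lemma comp3_composable (O M : Type) (X : cat_on O M) (f g h x : M) :
  is_comp3 X f g h x -> ctgt X f = csrc X g /\ ctgt X g = csrc X h.
Proof. by case=> e [e2 _]; split=> //; rewrite -e2 ctgt_comp. Qed.

Lemma normal_path (B : category) (A : pred (Ob B))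
    (R : functor B (cone (full_sub A))) (K O M OD MD : Type)
    (P : cat_on O M) (Y : cat_on OD MD) Fm uo um (vo : Ob B * K -> O) vm :
  is_functor Y P uo um -> is_functor (prod_on B (disc_on K)) P vo vm ->
  (forall (f : {f | sub_mor A f}) (k : K), um (Fm (f, k)) = vm (sval f, k)) ->
  forall x, normal R P uo um vm x ->
  let new y := exists f k, ~~ sub_mor A f /\ y = vm (f, k) in
  new x \/ exists f1 d f2, [/\ is_identity P f1 \/ new f1,
    is_identity P f2 \/ new f2 & is_comp3 P f1 (um d) f2 x].
Proof.
move=> hu hv hm x hx new.
have old d : is_comp3 P (cid P (uo (csrc Y d))) (um d) (cid P (uo (ctgt Y d))) (um d).
  have e1 := fun_src hu d; have e2 := fun_tgt hu d.
  have := @comp3I _ _ P (cid P (uo (csrc Y d))) (um d) (cid P (uo (ctgt Y d))).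
  by rewrite csrc_id ctgt_id tcomp_idr_at // tcomp_idl_at //; apply.
case: hx => [[f [k ->]]|[p [d [m [hp hl e e' ->]]]]].
  have [hf|hf] := boolP (sub_mor A f); last by left; exists f, k.
  (* An arrow of [A] comes from [D], and the path is padded with identities. *)
  right; rewrite -(hm (exist _ f hf)).
  exists (cid P (uo (csrc Y (Fm (exist _ f hf, k))))), (Fm (exist _ f hf, k)),
    (cid P (uo (ctgt Y (Fm (exist _ f hf, k))))).
  by split; [left; eexists | left; eexists |].
right; exists p, d, m; split; last exact: comp3I.
- case: hp => [[y ->]|[f [k [a [-> nf _ _]]]]]; first by left; exists (uo y).
  by right; exists f, k; rewrite /sub_mor (negbTE nf).
- case: hl => [[y ->]|[f [k [a [-> nf _ _]]]]]; first by left; exists (uo y).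
  by right; exists f, k; rewrite /sub_mor (negbTE nf) andbF.
Qed.

(** Over a thin target the functor laws are automatic, so the arrows may be picked by choice. *)
Lemma functor_to_thin (X T : category) (fo : Ob X -> Ob T) : thin T ->
  (forall f, exists m, csrc T m = fo (csrc X f) /\ ctgt T m = fo (ctgt X f)) ->
  exists G : functor X T, fob G = fo.
Proof.
move=> thinT /choice [fm hfm].
have hs f : csrc T (fm f) = fo (csrc X f) by case: (hfm f).
have ht f : ctgt T (fm f) = fo (ctgt X f) by case: (hfm f).
suff h : is_functor X T fo fm by exists (Functor h).
split=> // [x|f g e e']; apply: thinT.
- by rewrite hs !csrc_id.
- by rewrite ht !ctgt_id.
- by rewrite hs !csrc_comp hs.
- by rewrite ht !ctgt_comp ht.
Qed.

Lemma thin_cone (X : category) : thin X -> thin (cone X).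
Proof.
move=> h [[f|x]|[]] [[g|y]|[]] //=; first by move=> [es] [et]; rewrite (h f g).
by move=> _ [->].
Qed.

Lemma thin_preorder (T : Type) (r : rel T) (rr : reflexive r) (rt : transitive r) :
  thin (preorder_cat rr rt).
Proof.
move=> [[x y] h] [[x' y'] h']; rewrite /= /pre_src /pre_tgt /= => e e'.
by apply: sval_inj; rewrite /= e e'.
Qed.

Lemma full_sub_hom (B : category) (A : pred (Ob B)) (a b : Ob (full_sub A)) f :
  csrc B f = sval a -> ctgt B f = sval b ->
  exists m, csrc (full_sub A) m = a /\ ctgt (full_sub A) m = b.
Proof.
move=> es et; have hf : sub_mor A f by rewrite /sub_mor es et (svalP a) (svalP b).
by exists (exist _ f hf); split; apply: sval_inj.
Qed.

(* [R] is [pi] on the objects admitting a morphism from [A], and the new initial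
   object elsewhere.  The last condition gives a morphism [b -> pi b] inverse to
   the coreflection as soon as [b] has a morphism into [A]: for horns this forces
   [b] to lie in [A] already, for the walking isomorphism it always holds. *)
Definition partially_coreflective (B : category) (A : pred (Ob B)) : Prop :=
  thin B /\ exists R : functor B (cone (full_sub A)),
  [/\ forall a, fob R (sval a) = inl a,
      forall b a, fob R b = inl a ->
        exists f, csrc B f = sval a /\ ctgt B f = b
    & forall f, A (ctgt B f) -> exists a g,
        [/\ fob R (csrc B f) = inl a, csrc B g = csrc B f & ctgt B g = sval a]].

(** The coreflection is constant at the only object of [A], and the remaining conditions hold
    because any two objects are joined by an arrow. *)
Lemma point_iso_coreflective : partially_coreflective (incl_pred PointIso).
Proof.
split; first exact: thin_preorder.
pose a0 : Ob (full_sub (incl_pred PointIso)) := exist _ true erefl.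
have a0P (a : Ob (full_sub (incl_pred PointIso))) : a = a0.
  by apply: sval_inj; apply/eqP; apply: svalP a.
have hom (b b' : bool) : exists f : Mor walking_iso,
    csrc walking_iso f = b /\ ctgt walking_iso f = b'.
  by exists (exist (fun=> is_true true) (b, b') erefl).
have [||R eR] := @functor_to_thin walking_iso
    (cone (full_sub (incl_pred PointIso))) (fun=> inl a0).
- by apply: thin_cone; apply: thin_sub; apply: thin_preorder.
- move=> f; exists (inl (inl (cid (full_sub (incl_pred PointIso)) a0))).
  by split; congr inl; apply: a0P.
exists R; rewrite eR; split=> [a|b a|f _].
- by rewrite (a0P a).
- by move=> [<-]; apply: hom.
- by exists a0; have [g [gs gt]] := hom (csrc walking_iso f) true; exists g.
Qed.

(** * The coreflection onto the chains of a horn *)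

Section Horn.
Variables (m : nat) (k : 'I_m.+1).

(** A subchain has fewer terms to test. That horn chains form a sieve is also what rules out a
    nontrivial top factor of a square. *)
Lemma horn_chain_sieve (b c : chain m) :
  chain_le b c -> horn_chain k c -> horn_chain k b.
Proof.
move=> /subsetP h /forall_inP hc; apply/forall_inP => s /h; exact: hc.
Qed.

(** When nonempty, this is the largest subchain of [b] lying in the horn, that is, [pi b]. *)
Definition horn_part (b : chain m) : {set {set 'I_m.+1}} :=
  [set s in sval b | horn_face k s].

Lemma horn_part_chain b : horn_part b != set0 -> is_chain (horn_part b).
Proof.
move=> h; rewrite /is_chain h /=; case/and3P: (svalP b) => _ h0 /forall_inP hc.
apply/andP; split; first by rewrite inE negb_and h0.
apply/forall_inP => s; rewrite inE => /andP [hs _].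
apply/forall_inP => t; rewrite inE => /andP [ht _].
by have /forall_inP := hc s hs; apply.
Qed.

Lemma horn_part_horn b (h : is_chain (horn_part b)) :
  horn_chain k (exist _ (horn_part b) h).
Proof. by apply/forall_inP => s; rewrite inE => /andP []. Qed.

Lemma horn_part_id b : horn_chain k b -> horn_part b = sval b.
Proof.
move=> /forall_inP h; apply/setP => s; rewrite inE andbC.
by case: (boolP (s \in sval b)) => [/h ->|]; rewrite ?andbF.
Qed.

Lemma horn_part_sub b c : chain_le b c -> horn_part b \subset horn_part c.
Proof.
move=> /subsetP h; apply/subsetP => s; rewrite !inE => /andP [/h -> ->] //.
Qed.

Definition horn_coreflect (b : chain m) :
    Ob (cone (full_sub (incl_pred (Horn k)))) :=
  match pselect (is_chain (horn_part b)) with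
  | left h => inl (exist _ (exist _ (horn_part b) h) (horn_part_horn h))
  | right _ => inr tt
  end.

Lemma horn_coreflective : partially_coreflective (incl_pred (Horn k)).
Proof.
split; first exact: thin_preorder.
pose B := cSd2_simplex m.
have hom (b b' : chain m) : chain_le b b' -> exists f : Mor B,
    csrc B f = b /\ ctgt B f = b'.
  by move=> h; exists (exist _ (b, b') h).
have old (a : Ob (full_sub (incl_pred (Horn k)))) : horn_coreflect (sval a) = inl a.
  rewrite /horn_coreflect; case: pselect => [h|[]].
    congr inl; apply: sval_inj; apply: val_inj => /=.
    exact: horn_part_id (svalP a).
  rewrite horn_part_id; [exact: (svalP (sval a)) | exact: (svalP a)].
have [||R eR] := @functor_to_thin B
    (cone (full_sub (incl_pred (Horn k)))) horn_coreflect.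
- by apply: thin_cone; apply: thin_sub; apply: thin_preorder.
- move=> f; rewrite /horn_coreflect; have hf := horn_part_sub (svalP f).
  case: pselect => [h|h]; case: pselect => [h'|h'].
  + have [g [gs gt]] := hom (exist _ (horn_part (csrc B f)) h)
      (exist _ (horn_part (ctgt B f)) h') hf.
    have [n [ns nt]] := @full_sub_hom _ (incl_pred (Horn k))
      (exist _ (exist _ (horn_part (csrc B f)) h) (horn_part_horn h))
      (exist _ (exist _ (horn_part (ctgt B f)) h') (horn_part_horn h')) _ gs gt.
    by exists (inl (inl n)); rewrite /= -ns -nt.
  (* No arrow can go from an old object to the new initial one: a horn term of the smaller chain is
     also a term of the larger. *)
  + case: h'; apply: horn_part_chain; case/andP: h => h _.
    by apply: contraNneq h => e; rewrite -subset0 -e.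
  + by eexists (inl (inr _)).
  + by exists (inr tt).
exists R; rewrite eR; split=> [//|b a|f hf].
- rewrite /horn_coreflect; case: pselect => // h [<-] /=.
  by apply: hom; apply/subsetP => s; rewrite inE => /andP [].
(* By the sieve property the source is a horn chain, hence its own coreflection, and the required
   arrow is an identity. *)
- have hs : horn_chain k (csrc B f) := horn_chain_sieve (svalP f) hf.
  exists (exist _ (csrc B f) hs), (cid B (csrc B f)); rewrite csrc_id ctgt_id.
  split=> //; exact: (old (exist _ (csrc B f) hs)).
Qed.
End Horn.

(** * The explicit description of the pushout *)

Lemma incl_coreflective (j : incl_case) : partially_coreflective (incl_pred j).
Proof.
case: j => [m k|]; [exact: horn_coreflective | exact: point_iso_coreflective].
Qed.

Theorem theorem10p6 (j : incl_case) (C : category) (D P : dblcat)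
    (F : dblfunctor (extprod (full_sub (incl_pred j)) C) D)
    (u : dblfunctor D P) (v : dblfunctor (extprod (incl_cat j) C) P)
    (hP : is_pushout F
            (extprod_functor (full_incl (incl_pred j)) (functor_id C)) u v) :
  (* objects *)
  bijective (canonical_ob (incl_pred j) u v) /\
  (* horizontal 1-category *)
  is_iso_functor (canonical_hfunctor (incl_pred j) u v) /\
  (* vertical morphisms *)
  ((forall x : vmor P,
      new_vmor (incl_pred j) v x \/
      exists f1 d f2, vpath (incl_pred j) u v f1 d f2 x) /\
   (forall f1 d f2 x, vpath (incl_pred j) u v f1 d f2 x ->
      (~ is_identity (vcat P) f1 -> enters_at F v f1 (csrc (vcat D) d)) /\
      (~ is_identity (vcat P) f2 -> leaves_at F v f2 (ctgt (vcat D) d)))) /\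
  (* squares *)
  ((forall x : sq P,
      new_sq (incl_pred j) v x \/
      exists b1 d b2, vsq_path (incl_pred j) u v b1 d b2 x) /\
   (is_horn j -> forall b1 d b2 x, vsq_path (incl_pred j) u v b1 d b2 x ->
      is_identity (vsq P) b1)).
Proof.
have [thinB [R [R_old counit to_old]]] := incl_coreflective j.
have [ho _ hv hs] := hP.1.
have [allv alls] := all_generated thinB R_old counit to_old hP.
have inj_ob := bij_inj (pushout_objects hP).
(* Where a path passes between [extprod B C] and [D], the corner lies over [A], and injectivity of
   [u] on objects identifies it with an image under [F]. *)
have old_ob b c y : dfob v (b, c) = dfob u y ->
    exists2 a, b = sval a & y = dfob F (a, c).
  move=> e; have ha := vo_old inj_ob e.
  exists (exist _ b ha) => //; apply: (uo_inj inj_ob).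
  by rewrite -e; apply: (esym (ho (exist _ b ha, c))).
split; first exact: (pushout_objects hP).
split; first exact: (pushout_hcategory hP).
split; split.
- move=> x; have hx := vgen_normal thinB R_old counit to_old hP (allv x).
  exact: (@normal_path _ _ R _ _ _ _ _ _ _ (dfv F) _ _ _ _
    (df_vcat u) (df_vcat v) (fun f c => hv (f, c)) x hx).
- move=> f1 d f2 x [h1 h2 h3]; have [e1 e2] := comp3_composable h3.
  split=> hn.
  + case: h1 => // -[f [c [nf ef]]]; move: e1.
    rewrite ef (fun_tgt (df_vcat v)) (fun_src (df_vcat u)) => /old_ob [a ea ey].
    exists f, a, c; split=> //.
    (* The target of [f] is in [A] and [f] is not an arrow of the full subcategory, so its source is
       outside [A]. *)
    by move: nf; rewrite /sub_mor ea (svalP a) andbT.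
  + case: h2 => // -[f [c [nf ef]]]; move: e2.
    rewrite ef (fun_src (df_vcat v)) (fun_tgt (df_vcat u)) => /esym/old_ob [a ea ey].
    exists f, a, c; split=> //.
    by move: nf; rewrite /sub_mor ea (svalP a).
- move=> x; have hx := sgen_normal thinB R_old counit to_old hP (alls x).
  exact: (@normal_path _ _ R _ _ _ _ _ _ _ (dfsq F) _ _ _ _
    (df_vsq u) (df_vsq v) (fun f c => hs (f, c)) x hx).
(* A new square on top of [d] has its bottom in [D], so its vertical part [f] ends in [A]; by the
   sieve property [f] also starts in [A], contradicting newness. *)
- case: j F u v hP R {thinB R_old counit to_old ho hv hs allv alls inj_ob old_ob}
    => // m k F u v hP _ _ b1 d b2 x [[//|[f [g [nf ef]]]] _ h].
  have [] := comp3_composable h; rewrite ef (fun_tgt (df_vsq v)) (fun_src (df_vsq u)).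
  move=> /(vo_old (pushout_hmor_inj hP)) /= ht _.
  case/negP: nf; apply/andP; split; last exact: ht.
  exact: horn_chain_sieve (svalP f) ht.
Qed.
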